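(* Let $\mathbb{F}$ be a local field of characteristic $2$. Let $V$ be a finite-dimensional vector space over $\mathbb{F}$ and $V^*$ its dual space. Define $Z:=\{(v,\phi)\in V\times V^*\mid\langle v,\phi\rangle=0\}$. Then for every distribution $\xi$ on $V\times V^*$ such that both $\xi$ and its Fourier transform $\mathcal{F}(\xi)$ are supported on $Z$, the distribution $\xi$ is ''abs-homogeneous'' of degree $\dim V$; that is, for any $t\in\mathbb{F}^\times$ and any $\Phi\in\mathcal{S}(V\times V^* )$, $$|(t\xi)(\Phi)|=|t|^{\dim V}\cdot|\xi(\Phi)|.$$
   Context: A local field is a non-discrete locally compact topological field; in characteristic $2$ it is automatically non-archimedean. $|t|$ for $t\in\mathbb{F}$ is the normalized absolute value (the factor by which multiplication by $t$ scales Haar measure on $\mathbb{F}$). For a locally compact totally disconnected Hausdorff space $X$, $\mathcal{S}(X)$ is the space of locally constant compactly supported functions $X\to\mathbb{C}$; a distribution on $X$ is a $\mathbb{C}$-linear functional on $\mathcal{S}(X)$. It is supported on a closed set $Z$ if it vanishes on all functions in $\mathcal{S}(X)$ supported in $X\setminus Z$. For $t\in\mathbb{F}^\times$, $t\xi$ is the push-forward of $\xi$ under scaling by $t$: $(t\xi)(\Phi)=\xi(x\mapsto\Phi(t^{-1}x))$. Fix a nontrivial additive character $\psi$ of $\mathbb{F}$. The Fourier transform on $\mathcal{S}(V\times V^* )$ is taken with respect to the non-degenerate symmetric bilinear form $((u,u'),(v,v')):=\langle u,v'\rangle+\langle v,u'\rangle$ on $V\times V^*$: $\mathcal{F}(\Phi)(x)=\int\Phi(y)\psi((x,y))\,dy$,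 with the self-dual Haar measure. For distributions, $\mathcal{F}(\xi)(\Phi)=\xi(\mathcal{F}(\Phi))$. *)

(* Defs.v *)
From HB Require Import structures.
From mathcomp Require Import all_boot all_order all_algebra.
From mathcomp Require Import complex.
From mathcomp Require Import all_classical all_reals all_analysis.

Set Implicit Arguments.
Unset Strict Implicit.
Unset Printing Implicit Defensive.

Import Order.TTheory GRing.Theory Num.Theory.
Import numFieldNormedType.Exports.

Local Open Scope classical_set_scope.
Local Open Scope complex_scope.
Local Open Scope ring_scope.

HB.mixin Record TopZmodule_isTopField F
    & TopologicalZmodule F & GRing.Field F := {
  mulf_continuous : continuous (fun x : F * F => x.1 * x.2);
  invf_continuous : forall x : F, x != 0 -> {for x, continuous (@GRing.inv F)}
}.

#[short(type="topFieldType")]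
HB.structure Definition TopField :=
  {F of TopologicalZmodule F & GRing.Field F & TopZmodule_isTopField F}.

HB.mixin Record TopField_isLocalField F & TopField F := {
  lf_hausdorff : hausdorff_space F;
  lf_locally_compact : locally_compact [set: F];
  lf_nondiscrete : ~ (forall x : F, open [set x])
}.

#[short(type="localFieldType")]
HB.structure Definition LocalField :=
  {F of TopField F & TopField_isLocalField F}.

Definition coordinates (F : fieldType) (W : vectType F) (w : W) :
    'rV[F]_(\dim {: W}) := \row_i coord (vbasis {: W}) i w.

(* The canonical topology of a finite-dimensional space: the one transported
   from F^n by coordinates.  As addition and multiplication of F are
   continuous, it does not depend on the chosen basis. *)
Definition vtop (F : localFieldType) (W : vectType F) : Type :=
  initial_topology (@coordinates F W).

HB.instance Definition _ (F : localFieldType) (W : vectType F) :=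
  GRing.Lmodule.copy (vtop W) W.
HB.instance Definition _ (F : localFieldType) (W : vectType F) :=
  Topological.copy (vtop W) (initial_topology (@coordinates F W)).

Section Haar.
Variables (R : realType) (G : PreTopologicalZmodule.type).

(* g_sigma_algebraType needs a pointed carrier. *)
Definition pcarrier : Type := G.
HB.instance Definition _ := Choice.copy pcarrier G.
HB.instance Definition _ := isPointed.Build pcarrier (0 : G).

Definition borel := g_sigma_algebraType (@open G : set (set pcarrier)).

Implicit Type mu : {measure set borel -> \bar R}.

(* Nonzero translation-invariant Radon measure on the Borel sets of G. *)
Definition is_haar mu : Prop :=
  [/\ mu [set: borel] != 0%E,
      forall (g : G) (A : set G), measurable (A : set borel) ->
        mu [set g + x | x in A] = mu A,
      forall K : set G, compact K -> (mu K < +oo)%E,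
      forall A : set G, measurable (A : set borel) ->
        mu A = ereal_inf [set mu U | U in [set U : set G | open U /\ A `<=` U]]
    & forall U : set G, open U ->
        mu U = ereal_sup
          [set mu K | K in [set K : set G | compact K /\ K `<=` U]]].

Definition cintegral mu (f : G -> R[i]) : R[i] :=
  (\int[mu]_y complex.Re (f y)) +i* (\int[mu]_y complex.Im (f y)).

End Haar.

(* The normalized absolute value |t| attached to a Haar measure mu of F: the
   factor by which multiplication by t scales mu, which exists by uniqueness of
   Haar measure (0 is only the junk default of xget). *)
Definition modulus (R : realType) (F : localFieldType)
    (mu : {measure set borel F -> \bar R}) (t : F) : R :=
  xget 0 [set c : R | forall A : set F, measurable (A : set (borel F)) ->
                        mu [set t * x | x in A] = (c%:E * mu A)%E].

Section SchwartzSpace.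
Variables (R : realType) (X : topologicalType).

Definition fsupp (f : X -> R[i]) : set X := closure [set x | f x != 0].

Definition schwartz (f : X -> R[i]) : Prop :=
  (forall x, \forall y \near x, f y = f x) /\ compact (fsupp f).

(* A distribution is represented by any map whose restriction to the Schwartz
   space is C-linear; its values on other functions are never used. *)
Definition is_distribution (xi : (X -> R[i]) -> R[i]) : Prop :=
  forall (a : R[i]) (f g : X -> R[i]), schwartz f -> schwartz g ->
    xi (fun x => a * f x + g x) = a * xi f + xi g.

Definition supported_on (Z : set X) (xi : (X -> R[i]) -> R[i]) : Prop :=
  forall f, schwartz f -> fsupp f `<=` ~` Z -> xi f = 0.

End SchwartzSpace.

Definition additive_character (R : realType) (F : localFieldType)
    (psi : F -> R[i]) : Prop :=
  [/\ forall x y, psi (x + y) = psi x * psi y,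
      forall x, `|psi x| = 1
    & continuous (psi : F -> R[i]^o)].

Notation dualv V := 'Hom(V, _^o).

(* V x V^* with its canonical topology. *)
Notation phase V := (vtop (V * dualv V)%type).

Section PhaseSpace.
Variables (R : realType) (F : localFieldType) (V : vectType F).
Local Notation phase := (phase V).

Definition pairing (v : V) (phi : dualv V) : F := phi v.

Definition bform (x y : phase) : F := pairing x.1 y.2 + pairing y.1 x.2.

Definition zero_pairing : set phase := [set x | pairing x.1 x.2 = 0].

Definition fourier (psi : F -> R[i]) (nu : {measure set borel phase -> \bar R})
    (Phi : phase -> R[i]) : phase -> R[i] :=
  fun x => cintegral nu (fun y => Phi y * psi (bform x y)).

Definition self_dual (psi : F -> R[i])
    (nu : {measure set borel phase -> \bar R}) : Prop :=
  forall Phi, schwartz Phi ->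
    forall x, fourier psi nu (fourier psi nu Phi) x = Phi (- x).

Definition fourier_dist (psi : F -> R[i])
    (nu : {measure set borel phase -> \bar R})
    (xi : (phase -> R[i]) -> R[i]) : (phase -> R[i]) -> R[i] :=
  fun Phi => xi (fourier psi nu Phi).

Definition scale_dist (t : F) (xi : (phase -> R[i]) -> R[i]) :
    (phase -> R[i]) -> R[i] :=
  fun Phi => xi (fun x => Phi (t^-1 *: x)).

End PhaseSpace.

(* Main.v *)
Require Import Defs.
From HB Require Import structures.
From mathcomp Require Import all_boot all_order all_algebra.
From mathcomp Require Import complex.
From mathcomp Require Import all_classical all_reals all_analysis.
From mathcomp Require Import ring measurable_realfun.

Set Implicit Arguments.
Unset Strict Implicit.
Unset Printing Implicit Defensive.

Import Order.TTheory GRing.Theory Num.Theory.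
Import numFieldNormedType.Exports.

Local Open Scope classical_set_scope.
Local Open Scope complex_scope.
Local Open Scope ring_scope.

(* Write q(v, phi) = <v, phi>; its polar form is the bilinear form B defining
   the Fourier transform F.  Since psi (a q) = 1 on the zero set Z of q, the
   hypotheses say that xi is invariant under M_a : f |-> psi (a q) f and under
   F M_c F.  In SL_2 terms these are the upper and lower unipotents of the Weil
   representation, and completing the square shows that, for c = 1 / a,
     (M_a F M_c F M_a f) (x) = kappa (F f) (a x)
   for a Gauss sum kappa.  Thus xi (f) = kappa_a xi ((F f) (a .)); applying this
   to F f and to f (a .), with F o F = id in characteristic 2, gives
   |kappa_a| = |a|^dim V unless everything vanishes, without evaluating the
   Gauss sum.
   Only finite sums are integrated: a Schwartz function is a combination of
   indicators of cosets of a compact open subgroup H, and the transform of such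
   an indicator is supported on the orthogonal of H.  Compact open subgroups
   exist as soon as there is a nonzero Schwartz function (its stabilizer), so
   the structure theory of local fields is not needed. *)

Definition compact_open_subgroup (G : PreTopologicalZmodule.type) (H : set G) :=
  [/\ H 0, forall x y, H x -> H y -> H (x - y), open H & compact H].

Definition coset (G : zmodType) (x : G) (H : set G) : set G :=
  [set y | H (y - x)].

(** This is the conclusion of van Dantzig's theorem for totally disconnected groups. Here it is
    obtained by shrinking a single compact open subgroup with scalars, in
    [small_subgroups_scaling]. *)
Definition small_subgroups (G : PreTopologicalZmodule.type) :=
  forall U : set G, nbhs 0 U ->
    exists H, compact_open_subgroup H /\ H `<=` U.

(** * Schwartz functions and distributions *)

Section Schwartz.
Variables (R : realType) (X : topologicalType).
Implicit Types f g : X -> R[i].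

Lemma schwartz_lin (a : R[i]) f g :
  schwartz f -> schwartz g -> schwartz (fun x => a * f x + g x).
Proof.
move=> [lf cf] [lg cg]; split.
  move=> x; near=> y.
  have -> : f y = f x by near: y; exact: lf.
  by have -> : g y = g x by near: y; exact: lg.
apply: (subclosed_compact _ (compactU cf cg)); first exact: closed_closure.
rewrite -closureU; apply: closureS => x /=.
have [->|? _] := eqVneq (f x) 0; last by left.
by rewrite mulr0 add0r; right.
Unshelve. all: by end_near. Qed.

Lemma schwartz0 : schwartz (fun _ : X => 0 : R[i]).
Proof.
split; first by move=> x; near=> y.
suff -> : fsupp (fun _ : X => 0 : R[i]) = set0 by exact: compact0.
rewrite /fsupp (_ : [set x | _] = set0) ?closure0//.
by apply/seteqP; split=> x //=; rewrite eqxx.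
Unshelve. all: by end_near. Qed.

Lemma schwartz_indic (A : set X) :
  open A -> closed A -> compact A -> schwartz (\1_A : X -> R[i]).
Proof.
move=> oA cA kA; split.
  move=> x; have [Ax|nAx] := pselect (A x).
    have : nbhs x A by exact: open_nbhs_nbhs.
    by apply: filterS => y Ay; rewrite !indicE !mem_set.
  have : nbhs x (~` A) by apply: open_nbhs_nbhs; split=> //; exact: closed_openC.
  by apply: filterS => y Ay; rewrite !indicE !memNset.
apply: (subclosed_compact _ kA); first exact: closed_closure.
rewrite /fsupp [X in _ `<=` X](closure_id A).1//; apply: closureS => x /=.
by apply: contra_neqP => nAx; rewrite indicE memNset.
Qed.

Lemma schwartz_comp_homeo (u v : X -> X) f :
  continuous u -> continuous v -> cancel u v -> cancel v u ->
  schwartz f -> schwartz (f \o u).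
Proof.
move=> cu cv uv vu [lf cf]; split; first by move=> x; exact: (cu x _ (lf (u x))).
have kv : compact (v @` fsupp f).
  by apply: continuous_compact => //; exact: continuous_subspaceT.
apply: (subclosed_compact _ kv); first exact: closed_closure.
have -> : v @` fsupp f = u @^-1` fsupp f.
  apply/seteqP; split=> [_ [x fx <-]|x fx] /=; first by rewrite vu.
  by exists (u x).
rewrite [X in _ `<=` X](closure_id _).1; last first.
  by apply: preimage_closed => //; exact: closed_closure.
by apply: closureS => x /= fx; exact: subset_closure.
Qed.

(** The zero set of a locally constant function is open, so taking the closure adds nothing. *)
Lemma fsuppE f : (forall x, \forall y \near x, f y = f x) ->
  fsupp f = [set x | f x != 0].
Proof.
move=> lf; rewrite /fsupp -(closure_id _).1//.
rewrite -openC openE => x /= fx; rewrite /interior.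
apply: filterS (lf x) => y /= ->; exact: fx.
Qed.

Lemma schwartz_mul (c : X -> R[i]) f : (forall x, \forall y \near x, c y = c x) ->
  schwartz f -> schwartz (fun x => c x * f x).
Proof.
move=> lc [lf cf]; split.
  move=> x; near=> y.
  have -> : c y = c x by near: y; exact: lc.
  by have -> : f y = f x by near: y; exact: lf.
apply: (subclosed_compact _ cf); first exact: closed_closure.
apply: closureS => x /=.
by apply: contra_neq => ->; rewrite mulr0.
Unshelve. all: by end_near. Qed.

Lemma is_distribution0 (xi : (X -> R[i]) -> R[i]) :
  is_distribution xi -> xi (fun=> 0) = 0.
Proof.
move=> /(_ 1 _ _ schwartz0 schwartz0); rewrite mul1r.
rewrite (_ : (fun _ => _ + _) = (fun=> 0)); last by apply/funext => x; rewrite addr0.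
by move=> /(congr1 (fun z => z - xi (fun=> 0))); rewrite mul1r addrK subrr.
Qed.

Lemma is_distributionZ (xi : (X -> R[i]) -> R[i]) (a : R[i]) f :
  is_distribution xi -> schwartz f -> xi (fun x => a * f x) = a * xi f.
Proof.
move=> dxi sf; have := dxi a f _ sf schwartz0.
rewrite (is_distribution0 dxi) addr0 => <-.
by congr xi; apply/funext => x; rewrite addr0.
Qed.

End Schwartz.

(** * Compact open subgroups and uniqueness of invariant functionals *)

Section Group.
Variables (R : realType) (G : PreTopologicalZmodule.type).
(** A [PreTopologicalZmodule] does not relate its topology to its addition. Continuity is therefore
    assumed here; [addF] and [addX] supply it for the field and for [vtop W]. *)
Hypothesis addG : continuous (fun p : G * G => p.1 + p.2).
Local Notation C := R[i].
Implicit Types (f g : G -> C) (H : set G) (x : G).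

Lemma translate_continuous x : continuous (fun y : G => y + x).
Proof.
move=> y A Ayx; have [[U W] /= [yU xW] UW] := @addG (y, x) A Ayx.
apply: filterS yU => z Uz; apply: (UW (z, x)); split=> //.
exact: nbhs_singleton.
Qed.

Lemma open_coset x H : open H -> open (coset x H).
Proof.
move=> oH; apply: (@open_comp _ _ (fun y => y + - x)) => // y _.
exact: translate_continuous.
Qed.

Lemma subgroupN H x : compact_open_subgroup H -> H x -> H (- x).
Proof. by move=> [H0 HB _ _] Hx; rewrite -sub0r; exact: HB. Qed.

Lemma subgroupD H x y : compact_open_subgroup H -> H x -> H y -> H (x + y).
Proof.
move=> cH Hx Hy; rewrite -(opprK y); have [_ HB _ _] := cH.
by apply: HB => //; exact: subgroupN.
Qed.

(** The complement is a union of cosets, each of which is open. *)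
Lemma open_subgroup_closed H : H 0 ->
  (forall x y, H x -> H y -> H (x - y)) -> open H -> closed H.
Proof.
move=> H0 HB oH; have HN y : H y -> H (- y) by rewrite -sub0r; exact: HB.
have HD y z : H y -> H z -> H (y + z).
  by move=> Hy Hz; rewrite -(opprK z); apply: HB => //; exact: HN.
rewrite -openC openE => x nHx; rewrite /interior.
have : nbhs x (coset x H).
  by apply: open_nbhs_nbhs; split; [exact: open_coset|rewrite /coset /= subrr].
apply: filterS => y Hyx Hy; apply: nHx.
by rewrite -(subKr y x); exact: HB.
Qed.

Lemma subgroup_open H : (forall x y, H x -> H y -> H (x - y)) -> nbhs 0 H -> open H.
Proof.
move=> HB nH; have H0 : H 0 by exact: nbhs_singleton.
rewrite openE => h Hh; rewrite /interior.
have := @translate_continuous (- h) h H; rewrite subrr => /(_ nH) T.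
apply: (filterS _ (T : nbhs h [set y | H (y - h)])) => y /= Hyh.
rewrite (_ : y = y - h - (0 - h)); last by rewrite sub0r opprK subrK.
exact: (HB _ _ Hyh (HB _ _ H0 Hh)).
Qed.

Lemma compact_coset x H : compact H -> compact (coset x H).
Proof.
move=> kH; have -> : coset x H = (fun y => y + x) @` H.
  apply/seteqP; split=> [y Hy|_ [y Hy <-]]; last by rewrite /coset /= addrK.
  by exists (y - x) => //; rewrite subrK.
apply: continuous_compact => //; apply: continuous_subspaceT.
exact: translate_continuous.
Qed.

Lemma closed_coset x H : compact_open_subgroup H -> closed (coset x H).
Proof.
move=> [H0 HB oH kH]; apply: (preimage_closed (f := fun y => y + - x)).
  by move=> y _; exact: translate_continuous.
exact: open_subgroup_closed.
Qed.

Lemma schwartz_coset x H :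
  compact_open_subgroup H -> schwartz (\1_(coset x H) : G -> C).
Proof.
move=> cH; have [_ _ oH kH] := cH.
by apply: schwartz_indic; [exact: open_coset|exact: closed_coset|exact: compact_coset].
Qed.

Lemma coset0 H : coset 0 H = H.
Proof. by apply/seteqP; split=> y; rewrite /coset /= subr0. Qed.

Lemma schwartz_subgroup H : compact_open_subgroup H -> schwartz (\1_H : G -> C).
Proof. by move=> cH; rewrite -(coset0 H); exact: schwartz_coset. Qed.

Lemma compact_open_subgroupI H H' : compact_open_subgroup H ->
  compact_open_subgroup H' -> compact_open_subgroup (H `&` H').
Proof.
move=> [H0 HB oH kH] [H0' HB' oH' kH']; split=> //.
- by move=> x y [? ?] [? ?]; split; [exact: HB|exact: HB'].
- exact: openI.
- apply: (subclosed_compact _ kH) => //.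
  by apply: closedI; exact: open_subgroup_closed.
Qed.

Lemma schwartz_translate x f : schwartz f -> schwartz (fun y => f (y + x)).
Proof.
apply: (@schwartz_comp_homeo R G (fun y => y + x) (fun y => y - x)).
- exact: translate_continuous.
- exact: translate_continuous.
- exact: addrK.
- exact: subrK.
Qed.

Definition invariant_by f H := forall x h, H h -> f (x + h) = f x.

(** Compactness of the support gives a uniform neighbourhood of 0, but only for base points in the
    support; [exists_invariant] removes this restriction. *)
Lemma near_invariant f : schwartz f ->
  \forall h \near (0 : G), forall x, f x != 0 -> f (x + h) = f x.
Proof.
move=> [lf /compact_near_coveringP kf].
have : \forall h \near (0 : G), fsupp f `<=` (fun x => f (x + h) = f x).
  apply: (kf G (nbhs 0) (fun h x => f (x + h) = f x)) => x _.
  have A : \forall p \near (x, 0 : G), f (p.1 + p.2) = f x.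
    by have := @addG (x, 0) [set y | f y = f x]; rewrite /= addr0; apply; exact: lf.
  have B : \forall p \near (x, 0 : G), f p.1 = f x.
    exists ([set y | f y = f x], setT); last by move=> p [].
    by split; [exact: lf|exact: filterT].
  by apply: filterS2 A B => p; rewrite /= => -> ->.
by apply: filterS => h Hh x fx; apply: Hh; exact: subset_closure.
Qed.

Lemma exists_invariant f (U : set G) : small_subgroups G -> schwartz f ->
  nbhs 0 U ->
  exists H, [/\ compact_open_subgroup H, H `<=` U & invariant_by f H].
Proof.
move=> sG sf U0.
have [H [cH HU]] := sG _ (filterI U0 (near_invariant sf)).
exists H; split=> // [h /HU[]//|x h Hh].
(* If [f] vanishes at [x] but not at [x + h], apply the near invariance at [x + h] with the
   increment [- h]. *)
have [fx|fx] := eqVneq (f x) 0; last by have [_] := HU _ Hh; exact.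
apply: contrapT => /eqP; rewrite fx => fxh.
have [_ /(_ _ fxh)] := HU _ (subgroupN cH Hh).
by rewrite addrK fx => /eqP; rewrite eq_sym (negbTE fxh).
Qed.

Lemma invariant_byS f H H' : H' `<=` H -> invariant_by f H -> invariant_by f H'.
Proof. by move=> HH' fH x h /HH'; exact: fH. Qed.

Lemma invariant_subgroup H : compact_open_subgroup H ->
  invariant_by (\1_H : G -> C) H.
Proof.
move=> cH x h Hh; rewrite !indicE; congr (_%:R); congr nat_of_bool.
apply/idP/idP; rewrite !inE => ?; last exact: subgroupD.
by rewrite -(addrK h x); have [_ HB _ _] := cH; exact: HB.
Qed.

Lemma coset_cover (K : set G) H : H 0 -> open H -> compact K ->
  exists2 s : seq G, forall y, y \in s -> K y &
    forall x, K x -> exists2 y, y \in s & coset y H x.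
Proof.
move=> H0 oH /compact_near_coveringP kK.
(* The filter of properties shared by all sequences containing some fixed finite sequence. Along it,
   the near-covering form of compactness yields a finite subcover. *)
pose F : set_system (seq G) :=
  [set S : set (seq G) | exists s0 : seq G, forall s : seq G, {subset s0 <= s} -> S s].
have FF : Filter F.
  split; first by exists [::].
  - move=> S T [s Ss] [t Tt]; exists (s ++ t) => u stu; split.
      by apply: Ss => x xs; apply: stu; rewrite mem_cat xs.
    by apply: Tt => x xt; apply: stu; rewrite mem_cat xt orbT.
  - by move=> S T ST [s Ss]; exists s => t /Ss /ST.
have [|s Hs] := kK _ F (fun s x => exists2 y, y \in s /\ K y & coset y H x) FF.
  move=> x Kx; exists (coset x H, [set s : seq G | x \in s]) => /=.
    split; last by exists [:: x] => s; apply; rewrite inE.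
    by apply: open_nbhs_nbhs; split; [exact: open_coset|rewrite /coset /= subrr].
  by move=> [y s] [/= xy xs]; exists x.
exists [seq y <- s | `[<K y>]] => [y|x Kx].
  by rewrite mem_filter => /andP[/asboolP].
have [//|y [ys Ky] yx] := Hs s _ x Kx; exists y => //.
by rewrite mem_filter ys andbT; apply/asboolP.
Qed.

(* Induct on the number of cosets needed to cover the support. *)
Lemma schwartz_ind (P : (G -> C) -> Prop) f H :
  compact_open_subgroup H -> schwartz f -> invariant_by f H ->
  P (fun=> 0) ->
  (forall a g g', schwartz g -> schwartz g' -> P g -> P g' ->
    P (fun x => a * g x + g' x)) ->
  (forall x, f x != 0 -> P (\1_(coset x H))) ->
  P f.
Proof.
move=> cH sf fH P0 PD; have [H0 HB oH kH] := cH.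
have [s _ fs'] := coset_cover H0 oH sf.2.
have fs x : f x != 0 -> exists2 y, y \in s & coset y H x.
  by move=> fx; apply: fs'; exact: subset_closure.
clear fs'; elim: s f sf fH fs => [|y s IHs] f sf fH fs Pf.
  rewrite (_ : f = fun=> 0)//; apply/funext => x.
  by apply: contrapT => /eqP /fs[].
have [fy|fy] := eqVneq (f y) 0.
  apply: IHs => // x fx; have [z] := fs x fx.
  rewrite inE => /predU1P[->|zs] xz; last by exists z.
  by move: fx; rewrite -(subrK y x) addrC fH// fy eqxx.
(* Removing from [f] its constant value on the coset of [y] leaves an [H]-invariant function whose
   support is covered by the remaining cosets. *)
pose g x := f x * (1 - \1_(coset y H) x).
have -> : f = fun x => f y * \1_(coset y H) x + g x.
  apply/funext => x; rewrite /g indicE; have [yx|_] := boolP (x \in coset y H).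
    move: yx; rewrite inE => yx; rewrite subrr mulr0 addr0 mulr1.
    by rewrite -{1}(subrK y x) addrC fH.
  by rewrite subr0 mulr0 mulr1 add0r.
have gH : invariant_by g H.
  move=> x h Hh; rewrite /g fH//; congr (_ * (_ - _)); rewrite !indicE.
  congr (_%:R); congr nat_of_bool; apply/idP/idP; rewrite !inE /coset /=.
    by move=> Hxh; rewrite -(addrK h (x - y)) [x - y + h]addrAC; exact: HB.
  by move=> Hxy; rewrite addrAC; exact: subgroupD.
have gf x : g x != 0 -> f x != 0 /\ ~ coset y H x.
  rewrite /g indicE; have [xy|xy] := boolP (x \in coset y H).
    by rewrite subrr mulr0 eqxx.
  by rewrite subr0 mulr1; split=> //; move: xy; apply: contraNnot; rewrite inE.
have sg : schwartz g.
  have -> : g = fun x => -1 * (f x * \1_(coset y H) x) + f x.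
    by apply/funext => x; rewrite /g mulrBr mulr1 mulN1r addrC.
  by apply: schwartz_lin => //; apply: schwartz_mul; [exact: sf.1|exact: schwartz_coset].
apply: PD => //; [exact: schwartz_coset|exact: Pf|].
apply: IHs => // [x /gf[fx nyx]|x /gf[+ _]]; last exact: Pf.
have [z] := fs x fx; rewrite inE => /predU1P[->//|zs] zx; by exists z.
Qed.

Definition translation_invariant (I : (G -> C) -> C) :=
  forall f x, schwartz f -> I (fun y => f (y + x)) = I f.

Lemma invariant_coset I x H : compact_open_subgroup H ->
  translation_invariant I -> I (\1_(coset x H)) = I (\1_H).
Proof.
move=> cH tI; rewrite -(tI (\1_H) (- x)); last exact: schwartz_subgroup.
by congr I; apply/funext => y; rewrite !indicE; congr (_%:R); congr nat_of_bool;
  apply/idP/idP; rewrite !inE.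
Qed.

(** The scalar, the sum of the values of [f] over the cosets of [H], is chosen before the
    functional, so that one [s] serves two functionals at once. *)
Lemma haar_unique f H : compact_open_subgroup H -> schwartz f -> invariant_by f H ->
  exists s : C, forall I, is_distribution I -> translation_invariant I ->
    I f = s * I (\1_H).
Proof.
move=> cH sf fH; pose P g := exists s : C, forall I, is_distribution I ->
  translation_invariant I -> I g = s * I \1_H.
apply: (@schwartz_ind P f H) => //; rewrite /P.
- by exists 0 => I dI _; rewrite is_distribution0// mul0r.
- move=> a g g' sg sg' [s Hs] [s' Hs']; exists (a * s + s') => I dI tI.
  by rewrite dI// Hs// Hs'// mulrDl mulrA.
- by move=> x _; exists 1 => I dI tI; rewrite mul1r invariant_coset.
Qed.

(** Both functions are expanded over the cosets of one common subgroup. The cross-multiplied form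
    spares any nonvanishing condition. *)
Lemma haar_proportional f g I J : small_subgroups G ->
  is_distribution I -> translation_invariant I ->
  is_distribution J -> translation_invariant J ->
  schwartz f -> schwartz g -> I f * J g = J f * I g.
Proof.
move=> sG dI tI dJ tJ sf sg.
have [H [cH _ fH]] := exists_invariant sG sf (filterT).
have [H' [cH' _ gH']] := exists_invariant sG sg (filterT).
have cHH' := compact_open_subgroupI cH cH'.
have [|s Hs] := haar_unique cHH' sf.
  by apply: invariant_byS fH => x [].
have [|t Ht] := haar_unique cHH' sg.
  by apply: invariant_byS gH' => x [].
by rewrite !Hs// !Ht//; ring.
Qed.

End Group.
(** * Haar measures *)

Section Haar.
Variables (R : realType) (G : PreTopologicalZmodule.type).
Hypothesis addG : continuous (fun p : G * G => p.1 + p.2).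
Hypothesis hausG : hausdorff_space G.
Hypothesis smallG : small_subgroups G.
Variable mu : {measure set borel G -> \bar R}.
Hypothesis haar_mu : is_haar mu.
Local Notation C := R[i].
Local Notation mble := (@measurable _ (borel G)).
Implicit Types (f g : G -> C) (A H K U : set G) (x : G).

Lemma borel_open U : open U -> mble U.
Proof. by move=> oU; exact: sub_sigma_algebra. Qed.

Lemma borel_closed A : closed A -> mble A.
Proof.
move=> cA; rewrite -(setCK A); apply: measurableC; apply: borel_open.
exact: closed_openC.
Qed.

Lemma borel_compact K : compact K -> mble K.
Proof. by move=> kK; apply: borel_closed; exact: compact_closed. Qed.

Lemma haar_compact_fin K : compact K -> mu K \is a fin_num.
Proof.
by move=> kK; have [_ _ muK _ _] := haar_mu; rewrite ge0_fin_numE// muK.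
Qed.

Lemma haar_coset x H : open H -> mu (coset x H) = mu H.
Proof.
move=> oH; have [_ tmu _ _ _] := haar_mu.
rewrite -(tmu x H); last exact: borel_open.
congr (mu _); apply/seteqP; split=> [y Hy|_ [y Hy <-]].
  by exists (y - x) => //; rewrite addrC subrK.
by rewrite /coset /= addrC addKr.
Qed.

(** By compactness some [H] satisfies [K + H] inside [U]; finitely many cosets of [H] centred in [K]
    cover [K], and their union is the required set. *)
Lemma compact_open_between K U : compact K -> open U -> K `<=` U ->
  exists A, [/\ open A, compact A, K `<=` A & A `<=` U].
Proof.
move=> kK oU KU; have /compact_near_coveringP kK' := kK.
have : \forall h \near (0 : G), K `<=` (fun x => U (x + h)).
  apply: (kK' G (nbhs 0) (fun h x => U (x + h))) => x Kx.
  have := @addG (x, 0) U; rewrite /= addr0; apply.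
  by apply: open_nbhs_nbhs; split=> //; exact: KU.
move=> /smallG[H [cH HU]]; have [H0 HB oH kH] := cH.
have [s sK Ks] := coset_cover addG H0 oH kK.
exists [set x | exists2 y, y \in s & coset y H x]; split=> //; last first.
  move=> x [y ys Hy]; rewrite -(subrK y x) addrC.
  by apply: (HU _ Hy); exact: sK.
- elim: s {sK Ks} => [|y s IHs].
    rewrite (_ : [set _ | _] = set0); first exact: compact0.
    by apply/seteqP; split=> x // [].
  rewrite (_ : [set _ | _] = coset y H `|` [set x | exists2 y, y \in s & coset y H x]).
    by apply: compactU => //; exact: compact_coset.
  apply/seteqP; split=> [x [z]|x [yx|[z zs zx]]].
  - by rewrite inE => /predU1P[->|zs zx]; [left|right; exists z].
  - by exists y; rewrite ?mem_head.
  - by exists z; rewrite ?inE ?zs ?orbT.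
- rewrite (_ : [set _ | _] = \bigcup_(y in [set y | y \in s]) coset y H).
    by apply: bigcup_open => y _; exact: open_coset.
  by apply/seteqP; split=> x [y ys yx]; exists y.
Qed.

(** If [H] were null, every compact set, being covered by finitely many cosets of [H], would be
    null, and by inner regularity so would the whole group. *)
Lemma haar_subgroup_gt0 H : compact_open_subgroup H -> (0 < mu H)%E.
Proof.
move=> cH; have [H0 HB oH kH] := cH.
rewrite lt0e measure_ge0 andbT; apply/negP => /eqP muH.
have [/eqP muT _ _ _ innermu] := haar_mu; apply: muT.
apply/eqP; rewrite eq_le measure_ge0 andbT.
rewrite innermu; last exact: openT.
apply: ge_ereal_sup => _ [K [kK _] <-].
have [s _ Ks] := coset_cover addG H0 oH kK.
elim: s K kK Ks => [|y s IHs] K kK Ks.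
  rewrite (_ : K = set0) ?measure0//.
  by apply/seteqP; split=> x // /Ks[].
have mK : mble K by exact: borel_compact.
have mc : mble (coset y H) by apply: borel_open; exact: open_coset.
have kD : compact (K `\` coset y H).
  apply: (subclosed_compact _ kK) => //.
  by apply: closedI; [exact: compact_closed|exact/open_closedC/open_coset].
have mD : mble (K `\` coset y H) by exact: borel_compact.
apply: (@le_trans _ _ (mu (coset y H `|` (K `\` coset y H)))).
  apply: le_measure; rewrite ?inE//; first exact: measurableU.
  by move=> x Kx; have [?|?] := pselect (coset y H x); [left|right].
apply: (le_trans (measureU2 _ _ _)) => //.
have c0 : (mu (coset y H) <= 0)%E by rewrite haar_coset// muH.
have D0 : (mu (K `\` coset y H) <= 0)%E.
  apply: IHs => // x [/Ks[z]].
  by rewrite inE => /predU1P[->//|zs zx] _; exists z.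
by apply: (le_trans (leeD c0 D0)); rewrite adde0.
Qed.

(* Otherwise cosets of a small subgroup could be packed in [P] without bound. *)
Lemma open_subgroup_compact P : P 0 -> (forall x y, P x -> P y -> P (x - y)) ->
  open P -> mu P \is a fin_num -> compact P.
Proof.
move=> P0 PB oP Pfin.
have [H [cH HP]] := smallG (open_nbhs_nbhs (conj oP P0)).
have [H0 HB oH kH] := cH.
have muH := haar_subgroup_gt0 cH.
have muHfin := haar_compact_fin kH.
have [_ _ _ _ innermu] := haar_mu.
have e0 : 0 < fine (mu H) by rewrite fine_gt0// muH ltey_eq muHfin.
(* Choose a compact [K] inside [P] missing less than [mu H] of the measure of [P]. A coset of [H] in
   [P] disjoint from [K] would not fit, which forces [P = K + H]. *)
have := ub_ereal_sup_adherent e0; move=> /(_ [set mu K | K in [set K | compact K /\ K `<=` P]]).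
rewrite -innermu// fineK// => /(_ Pfin)[_ [K [kK KP] <-] muK].
pose KH := (fun p : G * G => p.1 + p.2) @` (K `*` H).
have kKH : compact KH.
  apply: continuous_compact; last exact: compact_setX.
  exact: continuous_subspaceT.
suff -> : P = KH by [].
have PD x y : P x -> P y -> P (x + y).
  move=> Px Py; rewrite -(opprK y); apply: (PB) => //; rewrite -sub0r; exact: PB.
apply/seteqP; split=> [x Px|_ [[y h] [/= Ky Hh] <-]]; last first.
  by apply: PD; [exact: KP|exact: HP].
apply: contrapT => nx; move: muK; apply/negP; rewrite -leNgt.
rewrite leeBrDr// -(haar_coset x oH) -measureU.
- apply: le_measure; rewrite ?inE.
  + by apply: measurableU; [exact: borel_compact|apply: borel_open; exact: open_coset].
  + exact: borel_open.
  + move=> y [/KP//|Hyx]; rewrite -(subrK x y); apply: PD => //; exact: HP.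
- exact: borel_compact.
- by apply: borel_open; exact: open_coset.
- apply/seteqP; split=> y // [Ky Hyx]; apply: nx; exists (y, x - y) => /=.
    by split=> //=; rewrite -opprB -sub0r; exact: HB.
  by rewrite addrC subrK.
Qed.

(** * Integration of complex-valued Schwartz functions *)

Lemma integrable_indic_fin A : mble A -> (mu A < +oo)%E ->
  mu.-integrable [set: borel G] (fun x => (\1_A x)%:E).
Proof.
move=> mA muA; apply/integrableP; split; first by apply/measurable_EFinP; exact: measurable_indic.
rewrite (eq_integral (fun x : borel G => (\1_A x)%:E)); last first.
  by move=> t _; rewrite gee0_abs// lee_fin.
by rewrite integral_indic// setIT.
Qed.

(** The grouping into two products and a remainder matches [integrable_lin]. *)
Lemma Re_lin (a b c : C) : complex.Re (a * b + c) =
  complex.Re a * complex.Re b + ((- complex.Im a) * complex.Im b + complex.Re c).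
Proof. by case: a b c => [? ?] [? ?] [? ?] /=; rewrite mulNr addrA. Qed.

Lemma Im_lin (a b c : C) : complex.Im (a * b + c) =
  complex.Re a * complex.Im b + (complex.Im a * complex.Re b + complex.Im c).
Proof. by case: a b c => [? ?] [? ?] [? ?] /=; rewrite addrA. Qed.

Definition cintegrable f :=
  mu.-integrable [set: borel G] (EFin \o (fun x : borel G => complex.Re (f x))) /\
  mu.-integrable [set: borel G] (EFin \o (fun x : borel G => complex.Im (f x))).

Lemma integrable_lin (a b : R) (u v w : borel G -> R) :
  mu.-integrable setT (EFin \o u) -> mu.-integrable setT (EFin \o v) ->
  mu.-integrable setT (EFin \o w) ->
  mu.-integrable setT (EFin \o (fun x => a * u x + (b * v x + w x))) /\
  Rintegral mu setT (fun x => a * u x + (b * v x + w x)) =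
  a * Rintegral mu setT u + (b * Rintegral mu setT v + Rintegral mu setT w).
Proof.
move=> iu iv iw; have mT : measurable [set: borel G] by exact: measurableT.
have iau : mu.-integrable setT (EFin \o (fun x => a * u x)).
  exact: (integrableZl mT a iu).
have ibv : mu.-integrable setT (EFin \o (fun x => b * v x)).
  exact: (integrableZl mT b iv).
have ibvw : mu.-integrable setT (EFin \o (fun x => b * v x + w x)).
  exact: (integrableD mT ibv iw).
split; first exact: (integrableD mT iau ibvw).
by rewrite RintegralD// RintegralD// !RintegralZl.
Qed.

Lemma cintegrable_lin (a : C) f g : cintegrable f -> cintegrable g ->
  cintegrable (fun x => a * f x + g x).
Proof.
move=> [rf jf] [rg jg]; split.
  rewrite (_ : (fun x => _) = fun x => complex.Re a * complex.Re (f x)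
      + ((- complex.Im a) * complex.Im (f x) + complex.Re (g x))).
    by have [] := integrable_lin (complex.Re a) (- complex.Im a) rf jf rg.
  by apply/funext => x; exact: Re_lin.
rewrite (_ : (fun x => _) = fun x => complex.Re a * complex.Im (f x)
    + (complex.Im a * complex.Re (f x) + complex.Im (g x))).
  by have [] := integrable_lin (complex.Re a) (complex.Im a) jf rf jg.
by apply/funext => x; exact: Im_lin.
Qed.

Lemma cintegral_lin (a : C) f g : cintegrable f -> cintegrable g ->
  cintegral mu (fun x => a * f x + g x) = a * cintegral mu f + cintegral mu g.
Proof.
move=> [rf jf] [rg jg]; rewrite {1}/cintegral.
under [X in X +i* _]eq_Rintegral do rewrite Re_lin.
under [X in _ +i* X]eq_Rintegral do rewrite Im_lin.
have [_ ->] := integrable_lin (complex.Re a) (- complex.Im a) rf jf rg.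
have [_ ->] := integrable_lin (complex.Re a) (complex.Im a) jf rf jg.
rewrite /cintegral; case: (a) => p q /=; apply/eqP; rewrite eq_complex /=.
by rewrite mulNr !addrA !eqxx.
Qed.

Lemma Re_indic A : (fun x : borel G => complex.Re (\1_A x : C)) = \1_A.
Proof. by apply/funext => x; rewrite !indicE; case: (_ \in _). Qed.

Lemma Im_indic A : (fun x : borel G => complex.Im (\1_A x : C)) = fun=> 0.
Proof. by apply/funext => x; rewrite !indicE; case: (_ \in _). Qed.

Lemma cintegrable_indic A : mble A -> (mu A < +oo)%E ->
  cintegrable (\1_A : G -> C).
Proof.
move=> mA muA; split; first by rewrite Re_indic; exact: integrable_indic_fin.
by rewrite Im_indic; exact: integrable0.
Qed.

Lemma cintegral_indic A : mble A -> cintegral mu (\1_A : G -> C) = (fine (mu A))%:C.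
Proof.
move=> mA; rewrite /cintegral /Rintegral.
under [X in fine X +i* _]eq_integral do rewrite [complex.Re _](congr1 (@^~ _) (Re_indic A)).
under [X in _ +i* fine X]eq_integral do rewrite [complex.Im _](congr1 (@^~ _) (Im_indic A)).
by rewrite integral0 integral_indic// setIT.
Qed.

Lemma schwartz_cintegrable f : schwartz f -> cintegrable f.
Proof.
move=> sf; have [H [cH _ fH]] := exists_invariant addG smallG sf filterT.
apply: (schwartz_ind addG cH sf fH).
- by split; exact: integrable0.
- by move=> a g g' _ _; exact: cintegrable_lin.
- move=> x _; have [_ _ oH kH] := cH.
  apply: cintegrable_indic; first by apply: borel_open; exact: open_coset.
  by rewrite haar_coset// ltey_eq haar_compact_fin.
Qed.

Lemma cintegral_distribution : is_distribution (cintegral mu : (G -> C) -> C).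
Proof.
by move=> a f g sf sg; apply: cintegral_lin; exact: schwartz_cintegrable.
Qed.

Lemma cintegral_invariant : translation_invariant (cintegral mu : (G -> C) -> C).
Proof.
move=> f x sf; have [H [cH _ fH]] := exists_invariant addG smallG sf filterT.
have [_ _ oH kH] := cH.
pose P g := cintegral mu (fun y => g (y + x)) = cintegral mu g.
apply: (schwartz_ind (P := P) addG cH sf fH); rewrite /P => //.
- move=> a g g' sg sg' Pg Pg'.
  by rewrite !cintegral_distribution ?Pg ?Pg'//; exact: schwartz_translate.
- move=> z _; rewrite (_ : (fun y => _) = \1_(coset (z - x) H)).
    rewrite !cintegral_indic ?haar_coset//; apply: borel_open; exact: open_coset.
  apply/funext => y; rewrite !indicE; congr (_%:R); congr nat_of_bool.
  have zxy : y - (z - x) = y + x - z by rewrite opprB addrCA addrC -!addrA [x - z]addrC.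
  by apply/idP/idP; rewrite !inE /coset /= zxy.
Qed.

(** * Haar measure under topological automorphisms *)

Section Automorphism.
Variables u v : G -> G.
Hypotheses (cu : continuous u) (cv : continuous v).
Hypotheses (uv : cancel u v) (vu : cancel v u).
Hypothesis uD : forall x y, u (x + y) = u x + u y.

Lemma automorphism_image A : u @` A = v @^-1` A.
Proof.
apply/seteqP; split=> [_ [x Ax <-]|x Ax] /=; first by rewrite uv.
by exists (v x).
Qed.

Lemma automorphism_measurable A : mble A -> mble (u @` A).
Proof.
move=> mA; rewrite automorphism_image -[X in mble X]setTI.
apply: (@measurability _ _ (borel G) (borel G) setT (v : borel G -> borel G) open) => //.
move=> _ [U oU <-]; rewrite setTI; apply: borel_open.
by apply: open_comp => // x _; exact: cv.
Qed.

Lemma automorphism_subgroup H :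
  compact_open_subgroup H -> compact_open_subgroup (u @` H).
Proof.
move=> [H0 HB oH kH]; have u0 : u 0 = 0.
  by apply: (@addrI _ (u 0)); rewrite -uD !addr0.
split.
- by exists 0.
- move=> _ _ [x Hx <-] [y Hy <-]; exists (x - y); first exact: HB.
  by apply: (@addIr _ (u y)); rewrite -uD !subrK.
- by rewrite automorphism_image; apply: open_comp => // x _; exact: cv.
- by apply: continuous_compact => //; exact: continuous_subspaceT.
Qed.

Lemma schwartz_automorphism f : schwartz f -> schwartz (f \o v).
Proof. exact: schwartz_comp_homeo. Qed.

Lemma distribution_automorphism (I : (G -> C) -> C) :
  is_distribution I -> is_distribution (fun f => I (f \o v)).
Proof.
move=> dI a f g sf sg.
by rewrite -(dI a (f \o v) (g \o v))//; exact: schwartz_automorphism.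
Qed.

Lemma invariant_automorphism (I : (G -> C) -> C) :
  translation_invariant I -> translation_invariant (fun f => I (f \o v)).
Proof.
move=> tI f x sf; rewrite -(tI (f \o v) (u x)); last exact: schwartz_automorphism.
congr I; apply/funext => y /=; congr f.
by apply: (can_inj uv); rewrite uD !vu.
Qed.

(** Inner regularity extends the bound from compact open sets to open sets, and outer regularity
    extends it to Borel sets. The reverse bound will come from the inverse automorphism. *)
Lemma haar_automorphism_le (c : R) : 0 < c ->
  (forall A, open A -> compact A -> mu (u @` A) = (c%:E * mu A)%E) ->
  forall A, mble A -> (mu (u @` A) <= c%:E * mu A)%E.
Proof.
move=> c0 Hc A mA; have [_ _ _ outermu innermu] := haar_mu.
have oimg U : open U -> open (u @` U).
  by move=> oU; rewrite automorphism_image; apply: open_comp => // x _; exact: cv.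
have leo U : open U -> (mu (u @` U) <= c%:E * mu U)%E.
  move=> oU; rewrite [in leLHS]innermu; last exact: oimg.
  apply: ge_ereal_sup => _ [K [kK KU] <-].
  have kvK : compact (v @` K).
    by apply: continuous_compact => //; exact: continuous_subspaceT.
  have [|B [oB kB KB BU]] := compact_open_between kvK oU.
    by move=> _ [x /KU [y Uy <-] <-]; rewrite uv.
  apply: (@le_trans _ _ (mu (u @` B))).
    apply: le_measure; rewrite ?inE.
    - exact: borel_compact.
    - by apply: borel_open; exact: oimg.
    - by move=> x Kx; exists (v x); [apply: KB; exists x|exact: vu].
  rewrite Hc// lee_pmul2l// ?lte_fin//.
  by apply: le_measure => //; rewrite inE; exact: borel_open.
rewrite -lee_pdivrMl// [leRHS]outermu//; apply: le_ereal_inf_tmp => _ [U [oU AU] <-].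
rewrite lee_pdivrMl//; apply: le_trans (leo _ oU).
apply: le_measure; rewrite ?inE.
- exact: automorphism_measurable.
- by apply: borel_open; exact: oimg.
- exact: image_subset.
Qed.

End Automorphism.

(** One compact open subgroup [H] determines the factor. Uniqueness of invariant functionals carries
    it to compact open sets, whose indicators are Schwartz, and regularity carries it to Borel
    sets. *)
Lemma haar_automorphism (u v : G -> G) : continuous u -> continuous v ->
  cancel u v -> cancel v u -> (forall x y, u (x + y) = u x + u y) ->
  exists2 c : R, 0 < c & forall A, mble A -> mu (u @` A) = (c%:E * mu A)%E.
Proof.
move=> cu cv uv vu uD.
have vD x y : v (x + y) = v x + v y by apply: (can_inj uv); rewrite uD !vu.
have [H [cH _]] := smallG filterT.
have cuH := automorphism_subgroup cu cv uv vu uD cH.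
have [_ _ oH kH] := cH; have [_ _ ouH kuH] := cuH.
have fin_gt0 K : compact_open_subgroup K -> 0 < fine (mu K).
  move=> cK; have [_ _ _ kK] := cK; rewrite fine_gt0// haar_subgroup_gt0//=.
  by rewrite ltey_eq haar_compact_fin.
pose c : R := fine (mu (u @` H)) / fine (mu H).
have c0 : 0 < c by rewrite divr_gt0// fin_gt0.
have uoc A : open A -> compact A -> open (u @` A) /\ compact (u @` A).
  move=> oA kA; split.
    by rewrite (automorphism_image uv vu); apply: open_comp => // x _; exact: cv.
  by apply: continuous_compact => //; exact: continuous_subspaceT.
have Hc A : open A -> compact A -> mu (u @` A) = (c%:E * mu A)%E.
  move=> oA kA; have [ouA kuA] := uoc A oA kA.
  have dI := cintegral_distribution; have tI := cintegral_invariant.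
  have sA : schwartz (\1_A : G -> C).
    by apply: schwartz_indic => //; exact: compact_closed.
  have sH : schwartz (\1_H : G -> C) by exact: schwartz_subgroup.
  have iv B : (\1_B : G -> C) \o v = \1_(u @` B).
    by apply/funext => x; rewrite /= !indicE (automorphism_image uv vu);
      congr (_%:R); congr nat_of_bool; apply/idP/idP; rewrite !inE.
  have := haar_proportional addG smallG dI tI
    (distribution_automorphism cu cv uv vu dI)
    (invariant_automorphism cu cv uv vu uD tI) sA sH.
  rewrite !iv !cintegral_indic; try exact: borel_open.
  rewrite -!rmorphM => -[E].
  rewrite -[LHS]fineK ?haar_compact_fin// -[mu A]fineK ?haar_compact_fin//.
  rewrite -EFinM; congr EFin.
  have muH0 : fine (mu H) != 0 by rewrite gt_eqF// fin_gt0.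
  by apply: (mulIf muH0); rewrite -E /c mulrAC divfK// mulrC.
have Hv A : open A -> compact A -> mu (v @` A) = (c^-1%:E * mu A)%E.
  move=> oA kA; rewrite -[in RHS](_ : u @` (v @` A) = A); last first.
    apply/seteqP; split=> [_ [_ [x Ax <-] <-]|x Ax]; first by rewrite vu.
    by exists (v x) => //; exists x.
  rewrite Hc ?muleA -?EFinM ?mulVf ?gt_eqF ?mul1e//.
    by rewrite (automorphism_image vu uv); apply: open_comp => // x _; exact: cu.
  by apply: continuous_compact => //; exact: continuous_subspaceT.
exists c => // A mA; apply/eqP; rewrite eq_le.
rewrite (haar_automorphism_le cv uv vu c0 Hc mA)/=.
have muA := automorphism_measurable cv uv vu mA.
have ci0 : 0 < c^-1 by rewrite invr_gt0.
have := haar_automorphism_le cu vu uv ci0 Hv muA.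
rewrite (_ : v @` (u @` A) = A); first by rewrite -lee_pdivrMl// invrK.
apply/seteqP; split=> [_ [_ [x Ax <-] <-]|x Ax]; first by rewrite uv.
by exists (u x) => //; exists x.
Qed.

End Haar.

(** * A compact open subgroup from a nonzero Schwartz function *)

Section Stabilizer.
Variables (R : realType) (G : PreTopologicalZmodule.type).
Hypothesis addG : continuous (fun p : G * G => p.1 + p.2).
Hypothesis oppG : continuous (fun x : G => - x).

(** Near invariance under both [h] and [- h] makes the stabilizer a neighbourhood of 0, hence open.
    It is compact because its translate by [x0] stays in the support of [f]. *)
Lemma stabilizer_subgroup (f : G -> R[i]) (x0 : G) : schwartz f -> f x0 != 0 ->
  compact_open_subgroup [set h | forall x, f (x + h) = f x].
Proof.
move=> sf fx0; set S := [set h | _].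
have S0 : S 0 by move=> x; rewrite addr0.
have SB x y : S x -> S y -> S (x - y).
  by move=> Sx Sy z; rewrite -(Sy (z + (x - y))) -addrA subrK Sx.
have nS : nbhs 0 S.
  have N := near_invariant addG sf.
  have N' : \forall h \near (0 : G), forall x, f x != 0 -> f (x - h) = f x.
    by have := @oppG 0 [set h | forall x, f x != 0 -> f (x + h) = f x]; rewrite oppr0; apply.
  apply: filterS2 N N' => h Hh Hh' x.
  have [fx|] := eqVneq (f x) 0; last exact: Hh.
  apply: contrapT => /eqP; rewrite fx => /[dup] fxh /Hh'.
  by rewrite addrK fx => /eqP; rewrite eq_sym (negbTE fxh).
have oS : open S by exact: subgroup_open.
split=> //; have kf := @compact_coset G addG (- x0) (fsupp f) sf.2.
apply: (subclosed_compact _ kf); first exact: open_subgroup_closed.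
by move=> h Sh; rewrite /coset /= opprK addrC; apply: subset_closure; rewrite /= Sh.
Qed.

End Stabilizer.

(** * Topology of finite-dimensional spaces *)

Section LocalField.
Variable F : localFieldType.

Lemma addF : continuous (fun p : F * F => p.1 + p.2).
Proof. exact: add_continuous. Qed.

(** Otherwise the point 0 would be open, and by translation [F] would be discrete. *)
Lemma near_neq0 (U : set F) : nbhs 0 U -> exists2 t, t != 0 & U t.
Proof.
move=> U0; apply: contrapT => nU; apply: (@lf_nondiscrete F) => x.
have n0 : nbhs 0 [set (0 : F)].
  by apply: filterS U0 => t Ut; apply: contrapT => /eqP t0; apply: nU; exists t.
rewrite openE => _ ->; rewrite /interior.
have := @translate_continuous F addF (- x) x [set 0]; rewrite subrr => /(_ n0) T.
apply: (filterS _ (T : nbhs x [set y | y - x = 0])) => y /= /eqP.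
by rewrite subr_eq0 => /eqP.
Qed.

Lemma continuousD_fun (Y : topologicalType) (f g : Y -> F) :
  continuous f -> continuous g -> continuous (fun y => f y + g y).
Proof.
move=> cf cg y; apply: (@cvg_comp _ _ _ (fun y => (f y, g y))
  (fun p : F * F => p.1 + p.2) _ (nbhs (f y, g y))); last exact: (@addF (f y, g y)).
by apply: cvg_pair; [exact: cf|exact: cg].
Qed.

Lemma continuousM_fun (Y : topologicalType) (f g : Y -> F) :
  continuous f -> continuous g -> continuous (fun y => f y * g y).
Proof.
move=> cf cg y; apply: (@cvg_comp _ _ _ (fun y => (f y, g y))
  (fun p : F * F => p.1 * p.2) _ (nbhs (f y, g y))); last exact: (@mulf_continuous F (f y, g y)).
by apply: cvg_pair; [exact: cf|exact: cg].
Qed.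

Lemma continuous_sum_fun (Y : topologicalType) (I : Type) (r : seq I)
    (f : I -> Y -> F) : (forall i, continuous (f i)) ->
  continuous (fun y => \sum_(i <- r) f i y).
Proof.
move=> cf; elim: r => [|i r IHr].
  under eq_fun do rewrite big_nil; exact: cst_continuous.
under eq_fun do rewrite big_cons; exact: continuousD_fun.
Qed.

Lemma small_subgroups_scaling (G : PreTopologicalZmodule.type)
    (act : F -> G -> G) (H : set G) :
  continuous (fun p : F * G => act p.1 p.2) ->
  (forall x, act 0 x = 0) -> (forall t x y, act t (x + y) = act t x + act t y) ->
  (forall t, t != 0 -> cancel (act t) (act t^-1)) ->
  compact_open_subgroup H -> small_subgroups G.
Proof.
move=> cact act0 actD actK cH U U0; have [H0 HB oH kH] := cH.
have : \forall t \near (0 : F), H `<=` (fun x => U (act t x)).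
  have /compact_near_coveringP kH' := kH.
  apply: (kH' F (nbhs 0) (fun t x => U (act t x))) => x Hx.
  have [|[A B] /= [A0 Bx] AB] := @cact (0, x) U; first by rewrite /= act0.
  by exists (B, A) => //= -[y t] [/= By At]; exact: (AB (t, y)).
move=> /near_neq0[t t0 HU]; exists (act t @` H); split; last first.
  by move=> _ [x Hx <-]; exact: HU.
have cactt s : continuous (act s).
  move=> x A Ax; have [[B C] /= [Bs Cx] BC] := @cact (s, x) A Ax.
  apply: filterS Cx => y Cy; apply: (BC (s, y)); split=> //.
  exact: nbhs_singleton.
have ti0 : t^-1 != 0 by rewrite invr_eq0.
apply: (@automorphism_subgroup G (act t) (act t^-1)) => //.
- exact: actK.
- by have := actK _ ti0; rewrite invrK.
Qed.

Lemma small_subgroupsF (H : set F) :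
  compact_open_subgroup H -> small_subgroups F.
Proof.
apply: (@small_subgroups_scaling F (fun t x => t * x)).
- exact: mulf_continuous.
- exact: mul0r.
- exact: mulrDr.
- exact: mulKf.
Qed.

(** * Coordinates and continuity on finite-dimensional spaces *)

Section Vtop.
Variable W : vectType F.
Local Notation X := (vtop W).
Local Notation n := (\dim {: W}).
Local Notation e := (vbasis {: W}).

Definition vcoord (i : 'I_n) (w : X) : F := coord e i (w : W).

Lemma vcoordP (a : F) (x y : X) i :
  vcoord i (a *: x + y) = a * vcoord i x + vcoord i y.
Proof. by rewrite /vcoord [LHS]linearP. Qed.

Lemma vcoordD (x y : X) i : vcoord i (x + y) = vcoord i x + vcoord i y.
Proof. by rewrite -[x]scale1r vcoordP mul1r scale1r. Qed.

Lemma vcoord0 i : vcoord i 0 = 0.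
Proof. by rewrite /vcoord [LHS]linear0. Qed.

Lemma vcoordZ (a : F) (x : X) i : vcoord i (a *: x) = a * vcoord i x.
Proof. by rewrite -[a *: x]addr0 vcoordP vcoord0 addr0. Qed.

Lemma vcoordK (x : X) : x = \sum_i vcoord i x *: (e`_i : X).
Proof. exact: (coord_vbasis (memvf (x : W))). Qed.

Lemma vcoord_inj (x y : X) : (forall i, vcoord i x = vcoord i y) -> x = y.
Proof.
by move=> xy; rewrite (vcoordK x) (vcoordK y); apply: eq_bigr => i _; rewrite xy.
Qed.

Lemma vcoord_basis (i j : 'I_n) : vcoord i (e`_j : X) = (i == j)%:R.
Proof. by rewrite /vcoord (coord_free j i (basis_free (vbasisP _))) eq_sym. Qed.

Lemma vcoord_continuous i : continuous (vcoord i).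
Proof.
move=> x A Ax.
have T : nbhs (coordinates (x : W)) [set M : 'rV[F]_n | A (M 0 i)].
  exists (fun _ j => if j == i then A else setT) => /=.
    move=> k j; case: eqP => [->|_]; last exact: filterT.
    by rewrite /coordinates mxE.
  by move=> M /(_ 0 i) /=; rewrite eqxx.
have S := @initial_continuous _ _ (@coordinates F W) x _ T.
apply: (filterS _ (S : nbhs x [set y : X | A (coordinates (y : W) 0 i)])) => y.
by rewrite /= mxE.
Qed.

(** The universal property of the initial topology, read in coordinates. *)
Lemma vtop_continuousP (Y : topologicalType) (f : Y -> X) :
  (forall i, continuous (fun y => vcoord i (f y))) -> continuous f.
Proof.
move=> cf; apply: continuous_comp_initial => y A [P Py PA].
have : \forall z \near y, forall i, P 0 i (vcoord i (f z)).
  apply: filter_forall => i; apply: cf.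
  by have := Py 0 i; rewrite /= /coordinates mxE.
by apply: filterS => z Hz; apply: PA => k i; rewrite ord1 /coordinates /= mxE; exact: Hz.
Qed.

Lemma addX : continuous (fun p : X * X => p.1 + p.2).
Proof.
apply: vtop_continuousP => i.
under eq_fun do rewrite vcoordD.
apply: continuousD_fun => p.
  by apply: (@cvg_comp _ _ _ fst (vcoord i) _ (nbhs p.1)); [exact: cvg_fst|exact: vcoord_continuous].
by apply: (@cvg_comp _ _ _ snd (vcoord i) _ (nbhs p.2)); [exact: cvg_snd|exact: vcoord_continuous].
Qed.

Lemma scaleX : continuous (fun p : F * X => p.1 *: p.2).
Proof.
apply: vtop_continuousP => i.
under eq_fun do rewrite vcoordZ.
apply: continuousM_fun => p; first exact: cvg_fst.
by apply: (@cvg_comp _ _ _ snd (vcoord i) _ (nbhs p.2)); [exact: cvg_snd|exact: vcoord_continuous].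
Qed.

Lemma scalevX (a : F) : continuous (fun x : X => a *: x).
Proof.
apply: vtop_continuousP => i; under eq_fun do rewrite vcoordZ.
by apply: continuousM_fun; [exact: cst_continuous|exact: vcoord_continuous].
Qed.

Lemma oppX : continuous (fun x : X => - x).
Proof. by under eq_fun do rewrite -scaleN1r; exact: scalevX. Qed.

Lemma hausdorffX : hausdorff_space X.
Proof.
move=> x y xy; apply: vcoord_inj => i; apply: (@lf_hausdorff F) => A B Ax By.
have [z [Az Bz]] := xy _ _ (@vcoord_continuous i x _ Ax) (@vcoord_continuous i y _ By).
by exists (vcoord i z).
Qed.

Lemma small_subgroupsX (H : set X) :
  compact_open_subgroup H -> small_subgroups X.
Proof.
apply: (@small_subgroups_scaling X (fun t x => t *: x)).
- exact: scaleX.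
- by move=> x; exact: scale0r.
- by move=> t x y; exact: scalerDr.
- by move=> t t0 x; exact: scalerK.
Qed.

Lemma bilinear_continuous (b : X -> X -> F) :
  (forall a x x' y, b (a *: x + x') y = a * b x y + b x' y) ->
  (forall a x y y', b x (a *: y + y') = a * b x y + b x y') ->
  continuous (fun p : X * X => b p.1 p.2).
Proof.
move=> bl br.
have bl0 y : b 0 y = 0.
  by have := bl 1 0 0 y; rewrite scale1r addr0 mul1r -[LHS]addr0 => /addrI.
have br0 x : b x 0 = 0.
  by have := br 1 x 0 0; rewrite scale1r addr0 mul1r -[LHS]addr0 => /addrI.
have bE x y : b x y = \sum_i \sum_j vcoord i x * (vcoord j y * b (e`_i : X) (e`_j : X)).
  rewrite {1}(vcoordK x).
  have -> : b (\sum_i vcoord i x *: (e`_i : X)) y = \sum_i vcoord i x * b (e`_i : X) y.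
    by elim/big_rec2: _ => [|i z s _ <-]; rewrite ?bl0 ?bl.
  apply: eq_bigr => i _; rewrite -mulr_sumr; congr (_ * _); rewrite {1}(vcoordK y).
  by elim/big_rec2: _ => [|j z s _ <-]; rewrite ?br0 ?br.
under eq_fun do rewrite bE.
apply: continuous_sum_fun => i; apply: continuous_sum_fun => j.
apply: continuousM_fun => [p|].
  by apply: (@cvg_comp _ _ _ fst (vcoord i) _ (nbhs p.1)); [exact: cvg_fst|exact: vcoord_continuous].
apply: continuousM_fun => p; last exact: cvg_cst.
by apply: (@cvg_comp _ _ _ snd (vcoord j) _ (nbhs p.2)); [exact: cvg_snd|exact: vcoord_continuous].
Qed.

(** This brings a compact open subgroup down to the base field, where scaling then produces
    arbitrarily small ones. *)
Lemma vcoord_subgroup (H : set X) (i : 'I_n) : compact_open_subgroup H ->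
  compact_open_subgroup (vcoord i @` H).
Proof.
move=> [H0 HB oH kH]; split.
- by exists 0 => //; exact: vcoord0.
- move=> _ _ [x Hx <-] [y Hy <-]; exists (x - y); first exact: HB.
  by rewrite addrC -scaleN1r vcoordP mulN1r addrC.
- rewrite openE => _ [x Hx <-]; rewrite /interior.
  (* Moving [x] along the [i]-th basis vector gives a continuous section of the coordinate, so the
     image of [H] contains a neighbourhood of [vcoord i x]. *)
  have cf : continuous (fun a : F => x + (a - vcoord i x) *: (e`_i : X)).
    apply: vtop_continuousP => j.
    under eq_fun do rewrite addrC vcoordP.
    apply: continuousD_fun; last exact: cst_continuous.
    apply: continuousM_fun; last exact: cst_continuous.
    exact: (translate_continuous addF).
  have := @cf (vcoord i x) H; rewrite subrr scale0r addr0 => /(_ _).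
  have nH : nbhs x H by exact: open_nbhs_nbhs.
  move=> /(_ nH) T; apply: (filterS _ (T : nbhs (vcoord i x)
    [set a | H (x + (a - vcoord i x) *: (e`_i : X))])) => a /= Ha.
  eexists; first exact: Ha.
  by rewrite addrC vcoordP vcoord_basis eqxx mulr1 subrK.
- by apply: continuous_compact => //; apply: continuous_subspaceT; exact: vcoord_continuous.
Qed.

End Vtop.
End LocalField.
(** * Scaling of Haar measures *)

Section Modulus.
Variables (R : realType) (F : localFieldType).
Hypothesis smallF : small_subgroups F.
Variable mu : {measure set borel F -> \bar R}.
Hypothesis haar_mu : is_haar mu.

Lemma modulusP (t : F) : t != 0 -> 0 < modulus mu t /\
  forall A : set F, @measurable _ (borel F) A ->
    mu [set t * x | x in A] = ((modulus mu t)%:E * mu A)%E.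
Proof.
move=> t0; have addF := @addF F; have hausF := @lf_hausdorff F.
have mulc (a : F) : continuous (fun x : F => a * x).
  by apply: continuousM_fun => x; [exact: cvg_cst|exact: cvg_id].
have [c c0 Hc] := haar_automorphism addF hausF smallF haar_mu
  (mulc t) (mulc t^-1) (mulKf t0) (mulVKf t0) (mulrDr t).
pose S := [set c : R | forall A : set F, @measurable _ (borel F) A ->
  mu [set t * x | x in A] = (c%:E * mu A)%E].
have mS : S (modulus mu t) by apply: (xgetPex 0); exists c.
split=> //; have [H [cH _]] := smallF filterT.
have H0 := haar_subgroup_gt0 addF hausF haar_mu cH.
have [_ _ oH kH] := cH.
have Hfin := haar_compact_fin haar_mu kH.
have mH : @measurable _ (borel F) H by exact: borel_open.
(* [xget] may return any admissible factor; on [H], of finite positive measure, it has to agree with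
   the positive factor [c]. *)
have := mS H mH; rewrite Hc// -(fineK Hfin) -!EFinM => -[].
move=> /mulIf <- //.
by rewrite gt_eqF// fine_gt0// H0 ltey_eq Hfin.
Qed.

End Modulus.

(** * The scaling factor on a finite-dimensional space *)

Section Scaling.
Variables (R : realType) (F : localFieldType) (W : vectType F).
Local Notation X := (vtop W).
Local Notation n := (\dim {: W}).
Local Notation e := (vbasis {: W}).
Local Notation C := R[i].
Variable St : set X.
Hypothesis cSt : compact_open_subgroup St.
Variables (mu : {measure set borel F -> \bar R}) (haar_mu : is_haar mu).
Variables (nu : {measure set borel X -> \bar R}) (haar_nu : is_haar nu).

Definition box (A : 'I_n -> set F) : set X := [set x | forall i, A i (vcoord i x)].

Lemma box_open A : (forall i, open (A i)) -> open (box A).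
Proof.
move=> oA; rewrite openE => x Ax; rewrite /interior.
have : nbhs (x : X) (fun y : X => forall i, A i (vcoord i y)).
  apply: (@filter_forall X 'I_n (fun i y => A i (vcoord i y)) (nbhs (x : X))) => i.
  apply: (@vcoord_continuous F W i x).
  by apply: open_nbhs_nbhs; split.
by apply: filterS.
Qed.

Lemma box_closed A : (forall i, closed (A i)) -> closed (box A).
Proof.
move=> cA; rewrite (_ : box A = \bigcap_(i in setT) (@vcoord F W i @^-1` A i)).
  apply: closed_bigI => i _; apply: preimage_closed => // x _.
  exact: vcoord_continuous.
by apply/seteqP; split=> x Ax i; [move=> _; exact: Ax|exact: Ax].
Qed.

Lemma box_compact A : (forall i, compact (A i)) -> (forall i, closed (A i)) ->
  compact (box A).
Proof.
move=> kA cA; have smallX := small_subgroupsX cSt; have [St0 StB oSt kSt] := cSt.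
(* One scalar shrinks every side of the box, so that it fits inside [St]. *)
have [N [HN NSt]] : exists N : 'I_n -> set F,
    (forall i, nbhs 0 (N i)) /\ box N `<=` St.
  have : nbhs (0 : X) St by exact: open_nbhs_nbhs.
  case=> B [/= [M oM <-] M0] MSt.
  have [P HP PM] : nbhs (coordinates (0 : W)) M by exact: open_nbhs_nbhs.
  exists (P 0); split=> [i|x Px].
    by have := HP 0 i; rewrite mxE [coord _ _ _](linear0 (coord e i)).
  apply: MSt; apply: PM => k i; rewrite ord1 mxE; exact: Px.
have : \forall t \near (0 : F), forall i, A i `<=` (fun x => N i (t * x)).
  apply: filter_forall => i; have /compact_near_coveringP kAi := kA i.
  apply: (kAi F (nbhs 0) (fun t x => N i (t * x))) => x Ax.
  have [|[P Q] /= [P0 Qx] PQ] := @mulf_continuous F (0, x) (N i).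
    by rewrite /= mul0r.
  by exists (Q, P) => //= -[y t] [/= Qy Pt]; exact: (PQ (t, y)).
move=> /near_neq0[t t0 Ht].
have kSt' : compact ((fun x : X => t^-1 *: x) @` St).
  by apply: continuous_compact => //; apply: continuous_subspaceT; exact: scalevX.
apply: (subclosed_compact _ kSt'); first exact: box_closed.
move=> x Ax; exists (t *: x); last exact: scalerK.
by apply: NSt => i; rewrite vcoordZ; exact: Ht.
Qed.

Hypothesis n_gt0 : (0 < n)%N.

Lemma small_subgroups_base : small_subgroups F.
Proof. exact: small_subgroupsF (vcoord_subgroup (Ordinal n_gt0) cSt). Qed.

Let smallX : small_subgroups X := small_subgroupsX cSt.
Let addX' := @addX F W.
Let hausX := @hausdorffX F W.

Lemma cst_near_comp (Y : topologicalType) (f : F -> C) (g : Y -> F) :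
  continuous g -> (forall a, \forall b \near a, f b = f a) ->
  forall y, \forall z \near y, f (g z) = f (g y).
Proof. by move=> cg lf y; exact: (cg y _ (lf (g y))). Qed.

(** With the other sides fixed, integration against [nu] becomes a translation-invariant functional
    of a function of the [j]-th coordinate, and uniqueness on [F] compares it with [mu]. No product
    measure is formed. *)
Lemma box_scale_coord (j : 'I_n) (t : F) (K : set F) (A : 'I_n -> set F) :
  t != 0 -> compact_open_subgroup K ->
  (forall i, compact_open_subgroup (A i)) ->
  cintegral nu (\1_(box (fun i => if i == j then [set t * x | x in K] else A i)) : X -> C) =
  (modulus mu t)%:C *
  cintegral nu (\1_(box (fun i => if i == j then K else A i)) : X -> C).
Proof.
move=> t0 cK cA.
have smallF := small_subgroups_base; have addF := @addF F.
have hausF := @lf_hausdorff F.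
have dnu := cintegral_distribution addX' smallX haar_nu.
have tnu := cintegral_invariant addX' smallX haar_nu.
have dmu := cintegral_distribution addF smallF haar_mu.
have tmu := cintegral_invariant addF smallF haar_mu.
pose Cyl := box (fun i => if i == j then setT else A i).
(* [E] pulls a function back along the [j]-th coordinate; the cylinder bounds the other coordinates
   and so restores compact support. *)
pose E (f : F -> C) : X -> C := fun x => \1_Cyl x * f (vcoord j x).
have oCyl : open Cyl.
  by apply: box_open => i; case: eqP => _; [exact: openT|have [] := cA i].
have cAi i : closed (A i).
  by have [? ? ? ?] := cA i; exact: (open_subgroup_closed addF).
have cCyl : closed Cyl.
  by apply: box_closed => i; case: eqP => _ //; exact: closedT.
have lCyl x : \forall y \near x, (\1_Cyl y : C) = \1_Cyl x.
  have [Ax|nAx] := pselect (Cyl x).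
    have : nbhs x Cyl by exact: open_nbhs_nbhs.
    by apply: filterS => y Ay; rewrite !indicE !mem_set.
  have : nbhs x (~` Cyl) by apply: open_nbhs_nbhs; split=> //; exact: closed_openC.
  by apply: filterS => y Ay; rewrite !indicE !memNset.
have sE f : schwartz f -> schwartz (E f).
  move=> [lf kf]; have lE x : \forall y \near x, E f y = E f x.
    near=> y; rewrite /E; congr (_ * _); near: y; first exact: lCyl.
    by apply: cst_near_comp => //; exact: vcoord_continuous.
  split=> //; have kb : compact (box (fun i => if i == j then fsupp f else A i)).
    apply: box_compact => i; case: eqP => _ //; first by have [] := cA i.
    exact: closed_closure.
  apply: (subclosed_compact _ kb); first exact: closed_closure.
  rewrite fsuppE// => x /=; rewrite /E indicE => fx i.
  have [xC|xC] := boolP (x \in Cyl); last by move: fx; rewrite (negbTE xC) mul0r eqxx.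
  move: xC; rewrite inE => /(_ i); case: eqP => [->|//] _.
  by apply: subset_closure => /=; apply: contra_neq fx => ->; rewrite mulr0.
pose L f := cintegral nu (E f).
have dL : is_distribution L.
  move=> a f g sf sg; rewrite /L -dnu; [|exact: sE..].
  by congr cintegral; apply/funext => x; rewrite /E mulrDr mulrCA.
have tL : translation_invariant L.
  (* A translation by [a] in the [j]-th coordinate comes from the translation by [a] times the
     [j]-th basis vector, which preserves [Cyl]. *)
  move=> f a sf; rewrite /L -[RHS](tnu _ (a *: (e`_j : X))); last exact: sE.
  congr cintegral; apply/funext => x; rewrite /E [x + _]addrC.
  rewrite vcoordP vcoord_basis eqxx mulr1 [a + _]addrC; congr (_ * _).
  rewrite !indicE; congr (_%:R); congr nat_of_bool.
  apply/idP/idP; rewrite !inE => Cx i; have := Cx i;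
    by rewrite vcoordP vcoord_basis; case: eqP => // _; rewrite mulr0 add0r.
have EA (K' : set F) : E (\1_K') = \1_(box (fun i => if i == j then K' else A i)).
  apply/funext => x; rewrite /E !indicE -natrM mulnb; congr (_%:R).
  congr nat_of_bool; apply/idP/idP.
    by move=> /andP[]; rewrite !inE => Cx Kx i; have := Cx i; case: eqP => [->|].
  rewrite !inE => Bx; apply/andP; split; rewrite inE.
    by move=> i; have := Bx i; case: eqP.
  by have := Bx j; rewrite eqxx.
rewrite -!EA -!/(L _).
have mulc (a : F) : continuous (fun x : F => a * x).
  by apply: continuousM_fun => x; [exact: cvg_cst|exact: cvg_id].
have ctK := automorphism_subgroup (mulc t) (mulc t^-1) (mulKf t0) (mulVKf t0)
  (mulrDr t) cK.
have [_ _ oK kK] := cK; have [_ _ otK ktK] := ctK.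
have := haar_proportional addF smallF dL tL dmu tmu
  (schwartz_subgroup R addF ctK) (schwartz_subgroup R addF cK).
have [m0 Hm] := modulusP smallF haar_mu t0.
rewrite !cintegral_indic; try exact: borel_open.
rewrite Hm; last exact: borel_open.
have K0 := haar_subgroup_gt0 addF hausF haar_mu cK.
have Kfin := haar_compact_fin haar_mu kK.
rewrite fineM// rmorphM/= mulrAC => /mulIf -> //.
by rewrite (inj_eq (@complexI _) _ 0) gt_eqF// fine_gt0// K0 ltey_eq Kfin.
Unshelve. all: by end_near. Qed.

(** The factor is computed on one box, a coordinate at a time, and uniqueness of invariant
    functionals transfers it to every [f]. *)
Lemma cintegral_scale (t : F) (f : X -> C) : t != 0 -> schwartz f ->
  cintegral nu (fun x => f (t^-1 *: x)) = (modulus mu t ^+ n)%:C * cintegral nu f.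
Proof.
move=> t0 sf; have smallF := small_subgroups_base.
have [K [cK _]] := smallF _ filterT.
have mulc (a : F) : continuous (fun x : F => a * x).
  by apply: continuousM_fun => x; [exact: cvg_cst|exact: cvg_id].
have ctK := automorphism_subgroup (mulc t) (mulc t^-1) (mulKf t0) (mulVKf t0)
  (mulrDr t) cK.
(* In [B k] the first [k] sides are scaled, so [B n] is [B 0] scaled by [t]. *)
pose B k := box (fun i : 'I_n => if (i < k)%N then [set t * x | x in K] else K).
have HB k : (k <= n)%N -> cintegral nu (\1_(B k) : X -> C) =
    (modulus mu t ^+ k)%:C * cintegral nu (\1_(B 0%N) : X -> C).
  elim: k => [_|k IHk kn]; first by rewrite expr0 mul1r.
  pose j := Ordinal kn; pose A (i : 'I_n) := if (i < k)%N then [set t * x | x in K] else K.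
  have cA i : compact_open_subgroup (A i) by rewrite /A; case: ifP.
  have := box_scale_coord j t0 cK cA.
  rewrite (_ : box _ = B k.+1); last first.
    congr box; apply/funext => i; rewrite /A [in RHS]ltnS [in RHS]leq_eqVlt -val_eqE /=.
    by case: eqP.
  rewrite (_ : box _ = B k); last first.
    congr box; apply/funext => i; rewrite /A -val_eqE /=.
    by case: eqP => [->|//]; rewrite ltnn.
  by move=> ->; rewrite IHk 1?ltnW// exprS rmorphM/= mulrA.
have cB : compact_open_subgroup (B 0%N).
  split.
  - by move=> i; rewrite vcoord0; have [] := cK.
  - move=> x y Bx By i; rewrite addrC -scaleN1r vcoordP mulN1r addrC.
    by have [_ KB _ _] := cK; apply: KB; [exact: Bx|exact: By].
  - by apply: box_open => i; have [] := cK.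
  - apply: box_compact => i; have [? ? ? ?] := cK => //.
    exact: (open_subgroup_closed (@addF F)).
have dnu := cintegral_distribution addX' smallX haar_nu.
have tnu := cintegral_invariant addX' smallX haar_nu.
have tK : cancel (fun x : X => t *: x) (fun x => t^-1 *: x).
  by move=> x; exact: scalerK.
have tVK : cancel (fun x : X => t^-1 *: x) (fun x => t *: x).
  by move=> x; exact: scalerKV.
have ct := @scalevX F W t; have cti := @scalevX F W t^-1.
have := haar_proportional addX' smallX
  (distribution_automorphism ct cti tK tVK dnu)
  (invariant_automorphism ct cti tK tVK (scalerDr t) tnu) dnu tnu sf
  (schwartz_subgroup R addX' cB).
rewrite (_ : \1_(B 0%N) \o _ = \1_(B n)); last first.
  apply/funext => x /=; rewrite !indicE; congr (_%:R); congr nat_of_bool.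
  apply/idP/idP; rewrite !inE => Bx i; have := Bx i; rewrite /= ltn_ord vcoordZ.
    by move=> Kx; eexists; [exact: Kx|rewrite mulVKf].
  by case=> y Ky <-; rewrite mulKf.
rewrite (HB _ (leqnn n)) => E.
have [_ _ oB kB] := cB.
have B0 := haar_subgroup_gt0 addX' hausX haar_nu cB.
have Bfin := haar_compact_fin haar_nu kB.
have I0 : cintegral nu (\1_(B 0%N) : X -> C) != 0.
  rewrite cintegral_indic; last exact: borel_open.
  by rewrite (inj_eq (@complexI _) _ 0) gt_eqF// fine_gt0// B0 ltey_eq Bfin.
by apply: (mulIf I0); rewrite [LHS]E; ring.
Qed.

End Scaling.
(** * The Weil representation *)

Section Phase.
Variables (R : realType) (F : localFieldType).
Hypothesis charF2 : 2%N \in [pchar F].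
Variables (V : vectType F) (psi : F -> R[i]).
Hypothesis psi_char : additive_character psi.
Local Notation X := (phase V).
Local Notation C := R[i].
Local Notation B := (@bform F V).

Definition qform (x : X) : F := pairing x.1 x.2.

Lemma addff (a : F) : a + a = 0.
Proof. exact: addrr_pchar2. Qed.

Lemma addxx (x : X) : x + x = 0.
Proof. by rewrite -[x]scale1r -scalerDl addff scale0r. Qed.

Lemma oppx (x : X) : - x = x.
Proof. by apply/eqP; rewrite -subr_eq0 -opprD addxx oppr0. Qed.

Lemma pairingPl (a : F) (x x' y : X) :
  pairing (a *: x + x').1 y.2 = a * pairing x.1 y.2 + pairing x'.1 y.2.
Proof. by rewrite /pairing [(a *: x + x').1]/(a *: x.1 + x'.1) linearP. Qed.

Lemma pairingPr (a : F) (x y y' : X) :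
  pairing x.1 (a *: y + y').2 = a * pairing x.1 y.2 + pairing x.1 y'.2.
Proof. by rewrite /pairing [(a *: y + y').2]/(a *: y.2 + y'.2) add_lfunE scale_lfunE. Qed.

Lemma bformC (x y : X) : B x y = B y x.
Proof. by rewrite /bform addrC. Qed.

Lemma bformPl (a : F) (x x' y : X) : B (a *: x + x') y = a * B x y + B x' y.
Proof. by rewrite /bform pairingPl pairingPr; ring. Qed.

Lemma bformPr (a : F) (x y y' : X) : B x (a *: y + y') = a * B x y + B x y'.
Proof. by rewrite !(bformC x) bformPl. Qed.

Lemma bformDl (x x' y : X) : B (x + x') y = B x y + B x' y.
Proof. by rewrite -[x]scale1r bformPl mul1r scale1r. Qed.

Lemma bformDr (x y y' : X) : B x (y + y') = B x y + B x y'.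
Proof. by rewrite !(bformC x) bformDl. Qed.

Lemma bform0r (x : X) : B x 0 = 0.
Proof. by apply: (@addrI _ (B x 0)); rewrite -bformDr !addr0. Qed.

Lemma bform0l (x : X) : B 0 x = 0.
Proof. by rewrite bformC bform0r. Qed.

Lemma bformZl (a : F) (x y : X) : B (a *: x) y = a * B x y.
Proof. by rewrite -[a *: x]addr0 bformPl bform0l addr0. Qed.

Lemma bformZr (a : F) (x y : X) : B x (a *: y) = a * B x y.
Proof. by rewrite !(bformC x) bformZl. Qed.

Lemma bformxx (x : X) : B x x = 0.
Proof. exact: addff. Qed.

Lemma qformD (x y : X) : qform (x + y) = qform x + qform y + B x y.
Proof.
rewrite /qform /bform -[x]scale1r pairingPl pairingPr [in X in _ + X]pairingPr.
by rewrite !scale1r !mul1r; ring.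
Qed.

Lemma qform0 : qform 0 = 0.
Proof.
have := pairingPl 1 0 0 0; rewrite scale1r addr0 mul1r -[LHS]addr0.
by move=> /addrI.
Qed.

Lemma qformZ (a : F) (x : X) : qform (a *: x) = a ^+ 2 * qform x.
Proof.
rewrite /qform /pairing [(a *: x).1]/(a *: x.1) [(a *: x).2]/(a *: x.2).
by rewrite scale_lfunE linearZ expr2 -mulrA.
Qed.

(* Otherwise [rewrite psiD] unfolds [B x y] and splits it as a sum. *)
Local Opaque bform.

Lemma bform_continuous : continuous (fun p : X * X => B p.1 p.2).
Proof. by apply: bilinear_continuous; [exact: bformPl|exact: bformPr]. Qed.

Lemma qform_continuous : continuous qform.
Proof.
have cb := bilinear_continuous pairingPl pairingPr => x A Ax.
have [[U W] /= [Ux Wx] UW] := cb (x, x) A Ax.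
by apply: filterS2 Ux Wx => y Uy Wy; exact: (UW (y, y)).
Qed.

Lemma psiD a b : psi (a + b) = psi a * psi b.
Proof. by have [-> _ _] := psi_char. Qed.

Lemma psi_neq0 a : psi a != 0.
Proof. by have [_ n _] := psi_char; rewrite -normr_eq0 n oner_eq0. Qed.

Lemma psi0 : psi 0 = 1.
Proof. by apply: (mulfI (psi_neq0 0)); rewrite -psiD addr0 mulr1. Qed.

Lemma psi_sqr a : psi a * psi a = 1.
Proof. by rewrite -psiD addff psi0. Qed.

(** In characteristic 2 the values of [psi] square to 1, so two distinct values are opposite and at
    distance 2; continuity with tolerance 1 excludes this. *)
Lemma psi_locally_constant a : \forall b \near a, psi b = psi a.
Proof.
have [_ n cpsi] := psi_char.
have /cvgrPdist_lt /(_ 1 ltr01) := cpsi a.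
apply: filterS => b; apply: contraTeq => ne.
have : (psi b - psi a) * (psi b + psi a) = 0.
  have -> : (psi b - psi a) * (psi b + psi a) = psi b * psi b - psi a * psi a by ring.
  by rewrite !psi_sqr subrr.
move=> /eqP; rewrite mulf_eq0 subr_eq0 (negbTE ne) /= addr_eq0 => /eqP ->.
by rewrite opprK -mulr2n normrMn n -real_leNgt ?realn ?real1// ler1n.
Qed.

Lemma psi_qformD (a : F) (x y : X) : psi (a * qform (x + y)) =
  psi (a * qform x) * psi (a * qform y) * psi (a * B x y).
Proof. by rewrite qformD -!psiD -!mulrDr. Qed.

Lemma psi_comp_locally_constant (Y : topologicalType) (f : Y -> F) :
  continuous f -> forall y, \forall z \near y, psi (f z) = psi (f y).
Proof. by move=> cf y; exact: (cf y _ (psi_locally_constant (f y))). Qed.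

Lemma psi_qform_locally_constant (c : F) (x : X) :
  \forall y \near x, psi (c * qform y) = psi (c * qform x).
Proof.
apply: (psi_comp_locally_constant (f := fun y => c * qform y)).
by apply: continuousM_fun; [exact: cst_continuous|exact: qform_continuous].
Qed.

Lemma psi_bform_locally_constant (x y : X) :
  \forall z \near y, psi (B x z) = psi (B x y).
Proof.
apply: (psi_comp_locally_constant (f := fun y => B x y)) => z A Az.
have [[U W] /= [Ux Wz] UW] := @bform_continuous (x, z) A Az.
apply: filterS Wz => w Ww; apply: (UW (x, w)); split=> //.
exact: (nbhs_singleton Ux).
Qed.

Lemma psi_bform_near (K : set X) (a : F) : compact K ->
  \forall h \near (0 : X), forall x, K x -> psi (a * B x h) = 1.
Proof.
move=> /compact_near_coveringP kK.
apply: (kK X (nbhs 0) (fun h x => psi (a * B x h) = 1)) => x Kx.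
have ca : continuous (fun p : X * X => a * B p.1 p.2).
  by apply: continuousM_fun; [exact: cst_continuous|exact: bform_continuous].
have := psi_comp_locally_constant ca (x, 0).
by rewrite /= bform0r mulr0 psi0.
Qed.

(* [psi (c * q x)] equals 1 on the zero set of [q]. *)
Lemma supported_mul (eta : (X -> C) -> C) (c : F) f : is_distribution eta ->
  supported_on (@zero_pairing F V) eta -> schwartz f ->
  eta (fun x => psi (c * qform x) * f x) = eta f.
Proof.
move=> deta seta sf.
have sm : schwartz (fun x => psi (c * qform x) * f x).
  exact: (schwartz_mul (psi_qform_locally_constant c)).
have sd := schwartz_lin (-1) sf sm.
apply/eqP; rewrite -subr_eq0 addrC -mulN1r -deta//.
(* By [fsuppE] the difference is nonzero at each point of its closed support, so that support avoids
   the zero set. *)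
apply/eqP; apply: seta => // x; rewrite fsuppE; last exact: sd.1.
move=> /= + qx; rewrite /qform [pairing _ _]qx mulr0 psi0 mul1r mulN1r addNr.
by rewrite eqxx.
Qed.

(** * The Fourier transform of Schwartz functions and Gauss sums *)

Variable St : set X.
Hypothesis cSt : compact_open_subgroup St.
Variables (nu : {measure set borel X -> \bar R}).
Hypotheses (haar_nu : is_haar nu) (nu_self_dual : self_dual psi nu).
Local Notation I := (cintegral nu : (X -> C) -> C).
Local Notation FT := (fourier psi nu).

Let addX' := @addX F (V * dualv V)%type.
Let hausX := @hausdorffX F (V * dualv V)%type.
Let smallX : small_subgroups X := small_subgroupsX cSt.
Let dI : is_distribution I := cintegral_distribution addX' smallX haar_nu.
Let tI : translation_invariant I := cintegral_invariant addX' smallX haar_nu.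

Lemma schwartz_psi f (x : X) : schwartz f -> schwartz (fun y => f y * psi (B x y)).
Proof.
move=> sf; under eq_fun do rewrite mulrC.
by apply: schwartz_mul => // y; exact: psi_bform_locally_constant.
Qed.

Lemma fourier_lin a f g : schwartz f -> schwartz g ->
  FT (fun x => a * f x + g x) = fun x => a * FT f x + FT g x.
Proof.
move=> sf sg; apply/funext => x; rewrite /fourier -dI; [|exact: schwartz_psi..].
by congr cintegral; apply/funext => y; rewrite mulrDl mulrA.
Qed.

Lemma fourier0 : FT (fun=> 0) = fun=> 0.
Proof.
apply/funext => x; rewrite /fourier (_ : (fun y => _) = fun=> 0) ?is_distribution0//.
by apply/funext => y; rewrite mul0r.
Qed.

Lemma fourierK f : schwartz f -> FT (FT f) = f.
Proof. by move=> sf; apply/funext => x; rewrite nu_self_dual// oppx. Qed.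

(** The annihilator of [H] under Pontryagin duality: [H] is only an additive subgroup, so the
    condition is on [psi (B x h)] and not on [B x h]. *)
Definition perp (H : set X) : set X := [set x | forall h, H h -> psi (B x h) = 1].

Definition vol (A : set X) : C := (fine (nu A))%:C.

(** The vanishing half of character orthogonality: [z] will be an integral that a translation
    multiplies by [psi a]. *)
Lemma psi_eq1_eq0 (a : F) (z : C) : psi a != 1 -> z = psi a * z -> z = 0.
Proof.
move=> psia /eqP; rewrite -subr_eq0 -{1}[z]mul1r -mulrBl mulf_eq0 subr_eq0 eq_sym.
by rewrite (negbTE psia) => /eqP.
Qed.

(** A translation reduces to [H] itself, over which the character [psi (B x _)] integrates to
    [vol H] when it is trivial and to 0 otherwise. *)
Lemma fourier_coset x0 H : compact_open_subgroup H ->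
  FT (\1_(coset x0 H)) = fun x => vol H * (psi (B x x0) * \1_(perp H) x).
Proof.
move=> cH; apply/funext => x; have [_ _ oH kH] := cH.
have sH := schwartz_subgroup R addX' cH.
have sc := @schwartz_coset R X addX' x0 H cH.
rewrite /fourier -(tI x0); last exact: schwartz_psi.
pose f y : C := \1_H y * psi (B x y).
have sf : schwartz f by exact: schwartz_psi.
rewrite (_ : (fun y => _) = fun y => psi (B x x0) * f y); last first.
  apply/funext => y; rewrite /f bformDr psiD mulrC -!mulrA mulrCA; congr (_ * _).
  rewrite mulrC !indicE; congr (_%:R * _); congr nat_of_bool.
  by apply/idP/idP; rewrite !inE /coset /= addrK.
rewrite is_distributionZ// mulrCA; congr (_ * _); rewrite indicE.
have [xP|] := boolP (x \in perp H).
  rewrite mulr1 (_ : f = \1_H); first by rewrite cintegral_indic//; exact: borel_open.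
  move: xP; rewrite inE => xP; apply/funext => y; rewrite /f indicE.
  have [|_] := boolP (y \in H); last by rewrite mul0r.
  by rewrite inE => /xP ->; rewrite mulr1.
rewrite notin_setE mulr0 => /existsNP[h /not_implyP[Hh /eqP xh]].
apply: (psi_eq1_eq0 xh); rewrite -is_distributionZ// -[LHS](tI h)//.
congr cintegral; apply/funext => y; rewrite /f bformDr psiD.
by rewrite (invariant_subgroup R cH _ Hh)// mulrA mulrC.
Qed.

Lemma perp_subgroup H : compact_open_subgroup H -> compact_open_subgroup (perp H).
Proof.
move=> cH; have [H0 HB oH kH] := cH.
have P0 : perp H 0 by move=> h _; rewrite bform0l psi0.
have PB x y : perp H x -> perp H y -> perp H (x - y).
  by move=> Px Py h Hh; rewrite oppx bformDl psiD Px// Py// mulr1.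
have oP : open (perp H).
  apply: (subgroup_open addX') => //; have := psi_bform_near 1 kH.
  by apply: filterS => x Hx h /Hx; rewrite mul1r bformC.
split=> //; apply: (open_subgroup_compact addX' hausX smallX haar_nu) => //.
(* By self-duality [perp H] has finite measure: the transform of its indicator
   does not vanish at the origin. *)
have muH := haar_subgroup_gt0 addX' hausX haar_nu cH.
have muHfin := haar_compact_fin haar_nu kH.
have v0 : vol H != 0.
  by rewrite /vol (inj_eq (@complexI _) _ 0) gt_eqF// fine_gt0// muH ltey_eq muHfin.
have sH := schwartz_subgroup R addX' cH.
have E : FT (fun x => (vol H)^-1 * \1_H x + 0) = \1_(perp H).
  rewrite fourier_lin//; last exact: schwartz0.
  have FH := fourier_coset 0 cH; rewrite coset0 in FH.
  rewrite FH; apply/funext => x.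
  rewrite bform0r psi0 mul1r mulKf//.
  by rewrite fourier0 addr0.
have sE := schwartz_lin (vol H)^-1 sH (schwartz0 R X).
have := nu_self_dual sE 0; rewrite E oppr0 addr0 indicE mem_set// mulr1 /fourier.
rewrite (_ : (fun y => _) = \1_(perp H)); last first.
  by apply/funext => y; rewrite bform0l psi0 mulr1.
rewrite cintegral_indic; last exact: borel_open.
(* [Ev] identifies [fine (nu (perp H))] with the inverse of [vol H]. As [fine] sends infinite values
   to 0, a nonzero value proves finiteness. *)
move=> Ev; have : fine (nu (perp H)) != 0.
  by rewrite -(inj_eq (@complexI _)) Ev invr_eq0.
by case: (nu (perp H)) => //=; rewrite eqxx.
Qed.

Lemma fourier_schwartz f : schwartz f -> schwartz (FT f).
Proof.
move=> sf; have [H [cH _ fH]] := exists_invariant addX' smallX sf filterT.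
apply: (schwartz_ind (P := fun g => schwartz (FT g)) addX' cH sf fH).
- by rewrite fourier0; exact: schwartz0.
- by move=> a g g' sg sg' Pg Pg'; rewrite fourier_lin//; exact: schwartz_lin.
- move=> x _; rewrite fourier_coset//.
  rewrite (_ : (fun y => _) = fun y => vol H * (psi (B x y) * \1_(perp H) y) + 0).
    apply: schwartz_lin; last exact: schwartz0.
    apply: schwartz_mul; first exact: psi_bform_locally_constant.
    by apply: (schwartz_subgroup R addX'); exact: perp_subgroup.
  by apply/funext => y; rewrite addr0 bformC.
Qed.

Lemma schwartz_scale (a : F) (f : X -> C) : a != 0 -> schwartz f ->
  schwartz (fun x : X => f (a *: x)).
Proof.
move=> a0; apply: (@schwartz_comp_homeo R X (fun x => a *: x) (fun x => a^-1 *: x)).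
- exact: scalevX.
- exact: scalevX.
- by move=> x; exact: scalerK.
- by move=> x; exact: scalerKV.
Qed.

(** For [P = perp H] and [c = a^-1] this is the constant kappa. Cutting off by a compact open [P]
    makes the integrand a Schwartz function. *)
Definition gauss (P : set X) (c : F) : C := I (fun y => \1_P y * psi (c * qform y)).

(* Completing the square: substitute [y + a z] for [y]. *)
Lemma gaussE (H : set X) (a : F) (z : X) : a != 0 -> compact_open_subgroup H ->
  (forall h, H h -> psi (a * qform h) = 1) ->
  I (fun y => \1_(perp H) y * psi (a^-1 * qform y + B z y)) =
  \1_(perp H) (a *: z) * psi (a * qform z) * gauss (perp H) a^-1.
Proof.
move=> a0 cH qH; have cP := perp_subgroup cH.
have sP := schwartz_subgroup R addX' cP.
pose g y : C := \1_(perp H) y * psi (a^-1 * qform y).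
have sg : schwartz g.
  rewrite /g; under eq_fun do rewrite mulrC.
  by apply: schwartz_mul => //; exact: psi_qform_locally_constant.
pose f y : C := \1_(perp H) y * psi (a^-1 * qform y + B z y).
have sf : schwartz f.
  rewrite /f (_ : (fun y => _) = fun y => g y * psi (B z y)); first exact: schwartz_psi.
  by apply/funext => y; rewrite psiD mulrA.
have shift x y : perp H (a *: x) -> f (y + a *: x) =
    \1_(perp H) y * psi (a^-1 * qform y + B z y + a * qform x + B y x + a * B z x).
  move=> Px; rewrite /f (invariant_subgroup R cP _ Px); congr (_ * psi _).
  by rewrite qformD qformZ bformDr !bformZr; field.
rewrite indicE; have [|] := boolP (a *: z \in perp H).
  rewrite inE => Pz; rewrite mul1r /gauss -is_distributionZ// -[LHS](tI (a *: z))//.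
  congr cintegral; apply/funext => y; rewrite [LHS]shift// [RHS]mulrCA; congr (_ * _).
  rewrite -psiD; congr psi; rewrite bformxx mulr0 addr0 (bformC y z).
  (* The linear term and the cross term of the square are equal, so they cancel in characteristic
     2. *)
  rewrite (_ : _ + _ + _ + B z y = a * qform z + a^-1 * qform y + (B z y + B z y)).
    by rewrite addff addr0.
  ring.
rewrite notin_setE => /existsNP[h /not_implyP[Hh /eqP zh]]; rewrite !mul0r.
(* Polarizing [psi (a * qform _) = 1] on [H] gives [psi (a * B h h') = 1]. The shift by [a *: h]
   thus preserves [perp H], and it multiplies the integral by a factor different from 1. *)
have Ph : perp H (a *: h).
  move=> h' Hh'; rewrite bformZl.
  have := qH _ (subgroupD cH Hh Hh').
  by rewrite psi_qformD !qH// !mul1r.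
apply: (psi_eq1_eq0 zh); rewrite -is_distributionZ// -[LHS](tI (a *: h))//.
congr cintegral; apply/funext => y; rewrite [LHS]shift// mulrCA indicE.
have [|_] := boolP (y \in perp H); last by rewrite !mul0r.
rewrite inE => Py; rewrite !mul1r psiD [psi (_ + B y h)]psiD.
by rewrite [psi (_ + a * qform h)]psiD (qH _ Hh) (Py _ Hh) !mulr1 bformZl mulrC.
Qed.

(** * Consequences of the two support conditions *)

Variable xi : (X -> C) -> C.
Hypotheses (xi_dist : is_distribution xi).
Hypotheses (xi_supp : supported_on (@zero_pairing F V) xi).
Hypotheses (fxi_supp : supported_on (@zero_pairing F V) (fourier_dist psi nu xi)).

Lemma fourier_dist_distribution : is_distribution (fourier_dist psi nu xi).
Proof.
move=> a f g sf sg; rewrite /fourier_dist fourier_lin//.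
by rewrite xi_dist//; exact: fourier_schwartz.
Qed.

(** On a single coset each operator is explicit: both conditions on [H] make [psi (a * qform _)]
    constant on [coset x0 H], and the remaining integral is the one evaluated in [gaussE]. *)
Lemma weil_coset (H : set X) (a : F) (x0 : X) : a != 0 -> compact_open_subgroup H ->
  (forall h, H h -> psi (a * qform h) = 1) ->
  (forall h, H h -> psi (a * B x0 h) = 1) ->
  xi (\1_(coset x0 H)) =
  gauss (perp H) a^-1 * xi (fun x : X => FT (\1_(coset x0 H)) (a *: x)).
Proof.
move=> a0 cH qH bH; set e : X -> C := \1_(coset x0 H).
have cP := perp_subgroup cH.
have se : schwartz e by exact: schwartz_coset.
have sFe := fourier_schwartz se.
have sFea : schwartz (fun x : X => FT e (a *: x)) by exact: schwartz_scale.
have xie : psi (a * qform x0) * xi e = xi e.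
  rewrite -is_distributionZ// -[RHS](supported_mul a xi_dist xi_supp se).
  congr xi; apply/funext => x; rewrite /e indicE.
  have [|_] := boolP (x \in coset x0 H); last by rewrite !mulr0.
  rewrite inE => xH; rewrite !mulr1.
  rewrite -[in RHS](subrK x0 x) [x - x0 + x0]addrC psi_qformD.
  by rewrite (qH (x - x0) xH) (bH (x - x0) xH) !mulr1.
(* Invariance of the transformed distribution, applied to [FT e], says that [xi] does not change
   when [e] is replaced by [FT] of [psi (a^-1 * qform _)] times [FT e]. *)
have := supported_mul a^-1 fourier_dist_distribution fxi_supp sFe.
rewrite /fourier_dist fourierK// => xieE.
(* The inner transform is a character times the indicator of [perp H], so the outer integral is
   [gaussE] at [z = x + x0]. *)
have E : FT (fun x => psi (a^-1 * qform x) * FT e x) =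
    fun x : X => gauss (perp H) a^-1 * psi (a * qform x0) *
      (psi (a * qform x) * FT e (a *: x)).
  apply/funext => x; rewrite fourier_coset// {1}/fourier.
  rewrite (_ : (fun y => _) = fun y => vol H *
      (\1_(perp H) y * psi (a^-1 * qform y + B (x + x0) y))); last first.
    apply/funext => y; rewrite bformDl addrA [psi (_ + B x0 y)]psiD.
    rewrite [psi (_ + B x y)]psiD (bformC y x0); ring.
  have sG : schwartz (fun y => (\1_(perp H) y : C) * psi (a^-1 * qform y + B (x + x0) y)).
    rewrite (_ : (fun y => _) = fun y => psi (a^-1 * qform y) *
        ((\1_(perp H) y : C) * psi (B (x + x0) y))).
      apply: schwartz_mul; first exact: psi_qform_locally_constant.
      by apply: schwartz_psi; exact: (schwartz_subgroup R addX').
    by apply/funext => y; rewrite psiD mulrCA.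
  rewrite is_distributionZ// gaussE// scalerDr.
  have Px0 : perp H (a *: x0) by move=> h Hh; rewrite bformZl bH.
  by rewrite (invariant_subgroup R cP _ Px0) psi_qformD bformZl; ring.
have smFea : schwartz (fun x : X => psi (a * qform x) * FT e (a *: x)).
  by apply: schwartz_mul => //; exact: psi_qform_locally_constant.
(* The quadratic factor inside [xi] is absorbed by [supported_mul], and the two remaining copies of
   [psi (a * qform x0)] multiply to 1. *)
rewrite -xie -[in LHS]xieE E is_distributionZ// (supported_mul a xi_dist xi_supp sFea).
by rewrite mulrA mulrCA psi_sqr mulr1.
Qed.

(** The constant depends on [H] and [a] only, so the coset case extends by linearity. The last
    condition is asked only where [f] is nonzero, since [schwartz_ind] meets no other cosets. *)
Lemma weil_identity (H : set X) (a : F) (f : X -> C) : a != 0 ->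
  compact_open_subgroup H -> schwartz f -> invariant_by f H ->
  (forall h, H h -> psi (a * qform h) = 1) ->
  (forall h, H h -> forall x, f x != 0 -> psi (a * B x h) = 1) ->
  xi f = gauss (perp H) a^-1 * xi (fun x : X => FT f (a *: x)).
Proof.
move=> a0 cH sf fH qH bH.
pose P g := xi g = gauss (perp H) a^-1 * xi (fun x : X => FT g (a *: x)).
apply: (schwartz_ind (P := P) addX' cH sf fH); rewrite /P.
- rewrite fourier0 [in RHS]is_distribution0// mulr0; exact: is_distribution0.
- move=> b g g' sg sg' Pg Pg'; rewrite fourier_lin// !xi_dist//; last 2 first.
    by apply: schwartz_scale => //; exact: fourier_schwartz.
    by apply: schwartz_scale => //; exact: fourier_schwartz.
  by rewrite Pg Pg'; ring.
- by move=> x fx; apply: weil_coset => // h Hh; exact: bH.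
Qed.

(* The constant is common to any two given functions: choose [H] small enough
   for both of them. *)
Lemma weil_identity2 (a : F) (f g : X -> C) : a != 0 -> schwartz f -> schwartz g ->
  exists k : C, xi f = k * xi (fun x : X => FT f (a *: x)) /\
    xi g = k * xi (fun x : X => FT g (a *: x)).
Proof.
move=> a0 sf sg.
have Uq : \forall h \near (0 : X), psi (a * qform h) = 1.
  by have := psi_qform_locally_constant a 0; rewrite qform0 mulr0 psi0.
have Uf := psi_bform_near a sf.2; have Ug := psi_bform_near a sg.2.
have [H [cH HU fH]] := exists_invariant addX' smallX sf (filterI Uq Uf).
have [H' [cH' HU' gH']] := exists_invariant addX' smallX sg (filterI Uq Ug).
have cHH' := compact_open_subgroupI addX' cH cH'.
exists (gauss (perp (H `&` H')) a^-1); split; apply: weil_identity => //.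
- by apply: invariant_byS fH => x [].
- by move=> h [/HU[]].
- by move=> h [/HU[_ Hh] _] x fx; apply: Hh; exact: subset_closure.
- by apply: invariant_byS gH' => x [].
- by move=> h [/HU[]].
- by move=> h [_ /HU'[_ Hh]] x gx; apply: Hh; exact: subset_closure.
Qed.

(** * Scaling and comparison of absolute values *)

Variables (mu : {measure set borel F -> \bar R}) (haar_mu : is_haar mu).
Hypothesis V_gt0 : (0 < \dim {: V})%N.

Lemma dim_phase : \dim {: (V * dualv V)%type} = (\dim {: V}).*2.
Proof. have E : dim (V * dualv V)%type = (dim V + dim V * 1)%N by [].
by rewrite !dimvf E muln1 addnn. Qed.

(** Substitute [a *: y] for [y] and move [a] across [B]. The exponent is doubled because the phase
    space has twice the dimension of [V]. *)
Lemma fourier_scale (a : F) (f : X -> C) : a != 0 -> schwartz f ->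
  (fun x : X => FT (fun y : X => f (a *: y)) (a *: x)) =
  fun x => (modulus mu a^-1 ^+ (\dim {: V}).*2)%:C * FT f x.
Proof.
move=> a0 sf; apply/funext => x; rewrite /fourier.
have sx : schwartz (fun y => f y * psi (B x y)) by exact: schwartz_psi.
have n0 : (0 < \dim {: (V * dualv V)%type})%N by rewrite dim_phase double_gt0.
have ai0 : a^-1 != 0 by rewrite invr_eq0.
have := cintegral_scale cSt haar_mu haar_nu n0 ai0 sx; rewrite dim_phase => <-.
by congr cintegral; apply/funext => y; rewrite invrK bformZl bformZr.
Qed.

Lemma abs_homogeneous (t : F) (f : X -> C) : t != 0 -> schwartz f ->
  `|scale_dist t xi f| = (modulus mu t ^+ \dim {: V})%:C * `|xi f|.
Proof.
move=> t0 sf; rewrite /scale_dist; set a := t^-1.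
have a0 : a != 0 by rewrite invr_eq0.
have sFf := fourier_schwartz sf.
have sfa := schwartz_scale a0 sf.
pose m := modulus mu t.
have m0 : 0 < m.
  have smallF : small_subgroups F.
    by apply: (small_subgroups_base cSt); rewrite dim_phase double_gt0.
  by have [] := modulusP smallF haar_mu t0.
(* At scalar 1, with [x] and [y] the values of [xi] at [f] and [FT f], this gives [x = k1 * y] and
   [y = k1 * x]. *)
have [k1 [E1 E2]] := weil_identity2 (oner_neq0 F) sf sFf.
(* At scalar [a], with [z] the value at the rescaled [f], this gives [y = k * z] and
   [z = k * M ^+ 2 * y], where [M] is the modulus of [t] to the power [\dim {: V}]. *)
have [k [E3 E4]] := weil_identity2 a0 sFf sfa.
rewrite fourierK// in E2 E3; rewrite fourier_scale// is_distributionZ// in E4.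
pose x := xi f; pose y := xi (FT f); pose z := xi (fun x : X => f (a *: x)).
have {}E1 : x = k1 * y.
  by rewrite /x E1; congr (_ * xi _); apply/funext => u; rewrite scale1r.
have {}E2 : y = k1 * x.
  by rewrite /y E2; congr (_ * xi _); apply/funext => u; rewrite scale1r.
have {}E3 : y = k * z by [].
have {}E4 : z = k * ((m ^+ (\dim {: V}).*2)%:C * y) by rewrite /z E4 invrK.
rewrite -/z -/x; have [y0|y0] := eqVneq y 0.
  by rewrite E4 E1 y0 !mulr0 normr0 mulr0.
set M := (m ^+ \dim {: V})%:C.
have M0 : 0 <= M by rewrite ler0c exprn_ge0// ltW.
have k1n : `|k1| = 1.
  apply/eqP; rewrite -sqrp_eq1// -normrX; apply/eqP.
  suff -> : k1 ^+ 2 = 1 by rewrite normr1.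
  by apply: (mulIf y0); rewrite mul1r expr2 -mulrA -E1.
have kn : `|k| * M = 1.
  apply/eqP; rewrite -sqrp_eq1 ?mulr_ge0// -(ger0_norm M0) -normrM -normrX; apply/eqP.
  suff -> : (k * M) ^+ 2 = 1 by rewrite normr1.
  apply: (mulIf y0); rewrite mul1r [RHS]E3 E4 -muln2 exprM rmorphXn/= -/M; ring.
by rewrite E1 normrM k1n mul1r E3 normrM mulrA [M * _]mulrC kn mul1r.
Qed.



End Phase.
Theorem theoremA1 (R : realType) (F : localFieldType)
  (charF2 : 2%N \in [pchar F])
  (mu : {measure set borel F -> \bar R}) (haar_mu : is_haar mu)
  (V : vectType F)
  (psi : F -> R[i]) (psi_char : additive_character psi)
  (psi_nontrivial : exists x, psi x != 1)
  (nu : {measure set borel (phase V) -> \bar R}) (haar_nu : is_haar nu)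
  (nu_self_dual : self_dual psi nu)
  (xi : (phase V -> R[i]) -> R[i]) (xi_dist : is_distribution xi)
  (xi_supp : supported_on (@zero_pairing F V) xi)
  (fxi_supp : supported_on (@zero_pairing F V) (fourier_dist psi nu xi)) :
  forall t : F, t != 0 -> forall Phi : phase V -> R[i], schwartz Phi ->
    `|scale_dist t xi Phi| = (modulus mu t ^+ \dim {: V})%:C * `|xi Phi|.
Proof.
move=> t t0 Phi sPhi.
(* In dimension 0 the phase space is a point and scaling is trivial; the scaling lemmas need a
   coordinate. *)
have [dimV0|dimV0] := posnP (\dim {: V}).
  rewrite dimV0 expr0 mul1r; congr (`|xi _|); apply/funext => x; congr Phi.
  by apply: vcoord_inj => i; exfalso; have := leq_ltn_trans (leq0n i) (ltn_ord i);
    rewrite (dim_phase V) dimV0.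
(* A point where [Phi] is nonzero gives the compact open subgroup from which all others are built;
   for [Phi = 0] both sides vanish. *)
have [[x0 Phix0]|Phi0] := pselect (exists x, Phi x != 0).
  have cSt := stabilizer_subgroup (@addX _ _) (@oppX _ _) sPhi Phix0.
  exact: (abs_homogeneous charF2 psi_char cSt haar_nu).
have -> : Phi = fun=> 0.
  by apply/funext => x; apply: contrapT => /eqP Phix; apply: Phi0; exists x.
by rewrite /scale_dist is_distribution0// normr0 mulr0.
Qed.
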